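(* There exists a universal constant $c>0$ such that for all $d\in\mathbb{N}$, all convex bodies $K\subset\mathbb{R}^d$ and all $\delta\in(0,e^{-1})$, the convex floating body $K_\delta$ is non-empty and $$d_{\mathfrak{L}}(K,K_\delta)\geq\frac{c\,d^{1/4}}{\log(2\delta^{-1})}.$$
   Context: A convex body in $\mathbb{R}^d$ is a compact convex set with non-empty interior. For $\theta\in S^{d-1}$ (the Euclidean unit sphere) and $t\in\mathbb{R}$ let $\mathfrak{H}_{\theta,t}=\{x\in\mathbb{R}^d:\langle x,\theta\rangle\geq t\}$. For a convex body $K\subset\mathbb{R}^d$ and $\delta>0$, the convex floating body inside $K$ is $$K_\delta=\bigcap\{\mathfrak{H}_{\theta,t}:\theta\in S^{d-1},\ t\in\mathbb{R},\ \mathrm{vol}_d(\mathfrak{H}_{\theta,t}\cap K)\geq(1-\delta)\,\mathrm{vol}_d(K)\}.$$ The logarithmic Hausdorff distance between convex bodies $K,L\subset\mathbb{R}^d$ is $$d_{\mathfrak{L}}(K,L)=\inf\{\lambda\geq 1:\exists x\in \mathrm{int}(K\cap L),\ \lambda^{-1}(K-x)+x\subset L\subset\lambda(K-x)+x\}.$$ $\log$ is the natural logarithm. *)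

(* Defs.v *)
(* MathComp-Analysis; real vector spaces are row vectors 'rV[R]_d over R : realType. *)
From HB Require Import structures.
From mathcomp Require Export all_boot all_order all_algebra.
From mathcomp Require Export all_classical all_reals all_analysis.
Export Order.TTheory GRing.Theory Num.Theory.
Export numFieldNormedType.Exports.

Set Implicit Arguments.
Unset Strict Implicit.
Unset Printing Implicit Defensive.

Local Open Scope classical_set_scope.
Local Open Scope ring_scope.

(* n-fold product of the Lebesgue measure of R, along
   R^{n+1} = R * R^n; the base case is the unit mass on the one-point space. *)
Fixpoint lebesgue_tuple (R : realType) (n : nat) :
    set (n.-tuple (measurableTypeR R)) -> \bar R :=
  match n with
  | 0 => \d_ [tuple]
  | m.+1 => pushforward (@lebesgue_measure R \x @lebesgue_tuple R m)%E
              (fun p => [tuple of p.1 :: p.2])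
  end.

Section Euclidean.
Variables (R : realType) (d : nat).
Implicit Types (K L : set 'rV[R]_d) (x y u v theta : 'rV[R]_d).

Definition vol K : \bar R :=
  @lebesgue_tuple R d [set s | K (\row_i tnth s i)].

Definition inner u v : R := \sum_(i < d) u ord0 i * v ord0 i.

(* The library's norm on 'rV is the sup norm, which only serves here to
   define the (usual) topology. *)
Definition enorm u : R := Num.sqrt (inner u u).

Definition unit_sphere : set 'rV[R]_d := [set theta | enorm theta = 1].

Definition halfspace theta (t : R) : set 'rV[R]_d :=
  [set x | t <= inner x theta].

Definition convex_body K : Prop :=
  [/\ compact K, @convex_set R 'rV[R]_d K & K° !=set0].

Definition floating_body K (delta : R) : set 'rV[R]_d :=
  \bigcap_(p in [set p : 'rV[R]_d * R | unit_sphere p.1 /\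
      ((1 - delta)%:E * vol K <= vol (halfspace p.1 p.2 `&` K))%E])
    halfspace p.1 p.2.

Definition dilate x (a : R) K : set 'rV[R]_d :=
  [set a *: (y - x) + x | y in K].

(* The infimum is taken in \bar R, so that it is +oo when no admissible
   lambda exists. *)
Definition log_hausdorff K L : \bar R :=
  ereal_inf [set lambda%:E | lambda in [set lambda : R | 1 <= lambda /\
    exists x, [/\ (K `&` L)° x, dilate x lambda^-1 K `<=` L
                & L `<=` dilate x lambda K]]].

End Euclidean.

(* Main.v *)
(* Write [V] for the volume of [K], [c] for its centroid, and
   [G(t) = vol {x in K : t <= <x - c, w>}].
   By Brunn-Minkowski [G] is log-concave, which has two consequences.
   (1) Gruenbaum: [G(0) >= V / e], so that a half-space carrying at least
   [(1 - delta) V] of the volume of [K] contains [c] when [delta < 1/e].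
   (2) If [sigma^2] is the variance of [<x, w>] on [K], Chebyshev gives
   [G(2 sigma) <= V/4 <= 3V/4 <= G(-2 sigma)], and log-concavity turns this
   ratio into geometric decay along the step [4 sigma]; hence [K_delta] lies in
   the slab [|<x - c, w>| <= C log(2/delta) sigma].
   On the other hand, with [S] the covariance matrix, [(x - c) S^-1 (x - c)^T]
   has average [d] on [K], so it is at least [d/2] at some [x] in [K]; for
   [w = (x - c) S^-1] this gives [<x - c, w> >= sqrt(d/2) sigma]. Comparing
   the widths in the direction [w] yields a lower bound of order
   [sqrt d / log(2/delta)], which is stronger than required. *)
Require Import Defs.
From HB Require Import structures.
From mathcomp Require Import all_boot all_order all_algebra.
From mathcomp Require Import all_classical all_reals all_analysis measurable_realfun.
From mathcomp Require Import ring lra.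
Import Order.TTheory GRing.Theory Num.Theory.
Import numFieldNormedType.Exports.

Set Implicit Arguments.
Unset Strict Implicit.
Unset Printing Implicit Defensive.

Local Open Scope classical_set_scope.
Local Open Scope ring_scope.

(** * One-dimensional Brunn-Minkowski and Prekopa-Leindler inequalities *)

(** The right-hand side is a measure in [A]. It gives each interval ]u, v] its length, and this
    characterises Lebesgue measure. *)
Lemma lebesgue_measure_doubling (R : realType) (b : R) (A : set (measurableTypeR R)) :
  measurable A ->
  (lebesgue_measure A = 2%:E *
     lebesgue_measure [set x : measurableTypeR R | A (2 * (x : R) - b)%R])%E.
Proof.
pose f (x : measurableTypeR R) : measurableTypeR R := 2 * (x : R) - b.
have mf : measurable_fun setT f.
  by apply: measurable_funB => //; exact: measurable_funM.
have f2 : 0 <= 2 :> R by [].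
pose fm := measure_function_pushforward__canonical__measure_function_Measure
  (@lebesgue_measure R) mf.
pose m : {measure set _ -> \bar R} := mscale (NngNum f2) fm.
move=> mA.
rewrite (@lebesgue_measure_unique R m _ A mA)//.
move=> _ [[u v]] _ <-.
rewrite /= /m /mscale /= /pushforward /=.
have -> : f @^-1` `]u, v]%classic = `](u + b) / 2, (v + b) / 2]%classic.
  apply/seteqP; split => x /=; rewrite !in_itv/= /f => /andP[] h1 h2; apply/andP; split; lra.
rewrite !lebesgue_measure_itv/= !lte_fin.
have -> : ((u + b) / 2 < (v + b) / 2) = (u < v) by apply/idP/idP => ?; lra.
case: ifP => _; last by rewrite mule0.
rewrite -EFinM; congr (_%:E); lra.
Qed.

(** Inner regularity. A point of [A] is added to the compact set to keep it non-empty, so that its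
    extrema exist. *)
Lemma compact_inner_approx (R : realType) (A : set R) (e : R) :
  measurable A -> (lebesgue_measure A < +oo)%E -> A !=set0 -> 0 < e ->
  exists V : set R, [/\ compact V, V !=set0, V `<=` A &
    (lebesgue_measure A <= lebesgue_measure V + e%:E)%E].
Proof.
move=> mA Afin [a Aa] e0.
have [V [cV VA AV]] := lebesgue_regularity_inner mA Afin e0.
have cVa : compact (V `|` [set a]) by apply: compactU => //; exact: compact_set1.
have mV := compact_measurable cV.
exists (V `|` [set a]); split => //.
- by exists a; right.
- by move=> x [/VA//|->].
rewrite (@measureDI _ _ _ (@lebesgue_measure R) A V)// addeC leeD//; last exact: ltW.
rewrite le_measure ?inE//; first exact: measurableI.
  exact: compact_measurable.
by move=> x [_ Vx]; left.
Qed.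

(* For compact [V], [W] the sets [(V + min W)/2] and [(max V + W)/2] lie in
   [(V + W)/2] and meet in a single point. *)
Lemma brunn_minkowski_line (R : realType) (A B C : set R) :
  measurable A -> measurable B -> measurable C ->
  A !=set0 -> B !=set0 ->
  (lebesgue_measure A < +oo)%E -> (lebesgue_measure B < +oo)%E ->
  (forall a b, A a -> B b -> C ((a + b) / 2)) ->
  (lebesgue_measure A + lebesgue_measure B <= 2%:E * lebesgue_measure C)%E.
Proof.
move=> mA mB mC A0 B0 fA fB ABC; apply/lee_addgt0Pr => e e0.
have e20 : 0 < e / 2 by rewrite divr_gt0.
have [V [cV V0 VA AV]] := @compact_inner_approx R A (e / 2) mA fA A0 e20.
have [W [cW W0 WB BW]] := @compact_inner_approx R B (e / 2) mB fB B0 e20.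
have mV := compact_measurable cV; have mW := compact_measurable cW.
have idc (U : set R) : {within U, continuous (@id R)}.
  by apply: continuous_subspaceT => x; exact: cvg_id.
have [a aV amax] := compact_EVT_max V0 cV (idc V).
have [b bW bmin] := compact_EVT_min W0 cW (idc W).
rewrite inE in aV; rewrite inE in bW.
pose P : set (measurableTypeR R) := [set x | V (2 * (x : R) - b)].
pose Q : set (measurableTypeR R) := [set x | W (2 * (x : R) - a)].
have maff (c : R) (U : set R) : measurable U ->
    measurable [set x : measurableTypeR R | U (2 * (x : R) - c)].
  move=> mU; rewrite -[X in measurable X]setTI.
  suff: measurable_fun (setT : set R) (fun x : R => 2 * x - c) by exact.
  by apply: measurable_funB => //; exact: measurable_funM.
have mP : measurable P := maff _ _ mV.
have mQ : measurable Q := maff _ _ mW.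
have PQC : (P `\` [set (a + b) / 2]) `|` Q `<=` C.
  move=> x [[Px _]|Qx].
    have -> : x = ((2 * x - b) + b) / 2 by lra.
    by apply: ABC; [exact: VA|exact: WB].
  have -> : x = (a + (2 * x - a)) / 2 by lra.
  by apply: ABC; [exact: VA|exact: WB].
(* With a = max V and b = min W, points of [P] are at most (a + b)/2 and points of [Q] at least (a +
   b)/2. Removing this one point costs no measure and makes the sets disjoint. *)
have PQ0 : (P `\` [set (a + b) / 2]) `&` Q = set0.
  rewrite -subset0 => x [[Px /= xab] Qx]; apply: xab => /=.
  have := amax (2 * x - b); rewrite inE => /(_ Px) h1.
  have := bmin (2 * x - a); rewrite inE => /(_ Qx) h2.
  by rewrite /= in h1 h2; apply/eqP; rewrite eq_le; apply/andP; split; lra.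
have mP' : measurable (P `\` [set (a + b) / 2]) by exact: measurableD.
have PP' : lebesgue_measure P = lebesgue_measure (P `\` [set (a + b) / 2]).
  rewrite (@measureDI _ _ _ (@lebesgue_measure R) P [set (a + b) / 2])//.
  rewrite (@subset_measure0 _ _ _ (@lebesgue_measure R) (P `&` [set (a + b) / 2]) [set (a + b) / 2])//.
  - by rewrite adde0.
  - exact: measurableI.
  - exact: lebesgue_measure_set1.
have muPQ : (lebesgue_measure P + lebesgue_measure Q <= lebesgue_measure C)%E.
  rewrite PP' -measureU// le_measure ?inE//; exact: measurableU.
apply: (le_trans (leeD AV BW)).
rewrite (@lebesgue_measure_doubling R b V mV) (@lebesgue_measure_doubling R a W mW).
rewrite [e in leRHS](_ : e = e / 2 + e / 2); last by lra.
rewrite EFinD addeACA leeD//.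
rewrite -ge0_muleDr//; apply: (lee_wpmul2l _ muPQ).
by rewrite adde_ge0.
Qed.

(** * The layer-cake formula and Prekopa-Leindler on the line *)

(** Tonelli for the indicator of the pairs (t, x) with 0 < t < 1 and t < f x: the section at x has
    length min(f x, 1). *)
Lemma layer_cake_unit (R : realType) d (T : measurableType d)
    (mu : {sigma_finite_measure set T -> \bar R}) (f : T -> \bar R) :
  measurable_fun setT f -> (forall x, 0 <= f x)%E ->
  (\int[@lebesgue_measure R]_(t in `]0%R, 1%R[) mu [set x | t%:E < f x] =
   \int[mu]_x Order.min (f x) 1)%E.
Proof.
move=> mf f0.
pose D : set (measurableTypeR R) := `]0, 1[%classic.
pose E : set (measurableTypeR R * T) :=
  (fst @^-1` D) `&` [set p | ((p.1 : R)%:E < f p.2)%E].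
have mE : measurable E.
  apply: measurableI.
    by rewrite -[X in measurable X]setTI; apply: measurable_fst => //; exact: measurable_itv.
  rewrite -[X in measurable X]setTI; apply: measurable_lte => //.
  - by apply/measurable_EFinP; exact: measurable_fst.
  - by apply: measurableT_comp => //; exact: measurable_snd.
have mEx (t : R) : measurable [set x | (t%:E < f x)%E].
  by rewrite -[X in measurable X]setTI; apply: measurable_lte.
have fubE : (\int[@lebesgue_measure R]_t \int[mu]_x (\1_E (t, x))%:E =
    \int[mu]_x \int[@lebesgue_measure R]_t (\1_E (t, x))%:E)%E.
  apply: (fubini_tonelli (fun p => (\1_E p)%:E)) => [|p]; last by rewrite lee_fin.
  by apply/measurable_EFinP; exact: measurable_indic.
transitivity (\int[@lebesgue_measure R]_t \int[mu]_x (\1_E (t, x))%:E)%E.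
  rewrite integral_mkcond; apply: eq_integral => t _; rewrite patchE.
  case: ifPn => tD.
    rewrite -[X in mu X]setIT -integral_indic//.
    apply: eq_integral => x _; rewrite !indicE; congr (_%:R%:E); congr nat_of_bool.
    rewrite inE in tD; apply/idP/idP; rewrite !inE /E/=; last by case.
    by move=> ?; split.
  rewrite [RHS]integral0_eq// => x _; rewrite indicE memNset// => -[] /= tD' _.
  by move: tD; rewrite notin_setE.
rewrite fubE; apply: eq_integral => x _.
have -> : (\int[@lebesgue_measure R]_t (\1_E (t, x))%:E =
    lebesgue_measure (D `&` [set t : R | t%:E < f x]))%E.
  rewrite -[X in lebesgue_measure X]setIT -integral_indic//; last first.
    apply: measurableI; first exact: measurable_itv.
    rewrite -[X in measurable X]setTI; apply: measurable_lte => //.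
move: (f0 x); case: (f x) => [r| |] //= r0.
- rewrite (_ : D `&` _ = `]0, (Order.min r 1)[%classic); last first.
    apply/seteqP; split => t /=; rewrite /D /= !in_itv/= lte_fin lt_min.
      by move=> [/andP[-> ->] ->].
    by move=> /and3P[-> -> ->].
  rewrite lebesgue_measure_itv/= -EFin_min; rewrite lee_fin in r0.
  rewrite lte_fin sube0; case: ifPn => //; rewrite -leNgt => h.
  by congr (_%:E); apply/eqP; rewrite eq_le h le_min r0 ler01.
- rewrite (_ : D `&` _ = D); last first.
    by apply/seteqP; split => t /=; [case|move=> ?; rewrite ltry].
  by rewrite lebesgue_measure_itv/= lte_fin ltr01 sube0 minye.
Qed.

Lemma measurable_superlevel_mass (R : realType) d (T : measurableType d)
    (mu : {sigma_finite_measure set T -> \bar R}) (f : T -> \bar R) :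
  measurable_fun setT f ->
  measurable_fun setT
    (fun t : measurableTypeR R => mu [set x | (t : R)%:E < f x]%E).
Proof.
move=> mf.
pose E : set (measurableTypeR R * T) := [set p | ((p.1 : R)%:E < f p.2)%E].
have mE : measurable E.
  rewrite -[X in measurable X]setTI; apply: measurable_lte => //.
  - by apply/measurable_EFinP; exact: measurable_fst.
  - by apply: measurableT_comp => //; exact: measurable_snd.
have := measurable_fun_xsection mu mE.
congr measurable_fun; apply/funext => t /=; congr (mu _).
by apply/seteqP; split => x; rewrite /xsection /E /= inE.
Qed.

(** When f and g have supremum 1, their superlevel sets at each t in ]0, 1[ are non-empty and have
    their midpoints in that of h. The one-dimensional Brunn-Minkowski inequality applies at each
    level, and integrating over t gives an additive inequality. The bounded support keeps the level
    sets of finite measure. *)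
Lemma prekopa_leindler_sup1 (R : realType) (f g h : R -> \bar R)
    (B : R) :
  measurable_fun setT f -> measurable_fun setT g -> measurable_fun setT h ->
  (forall x, 0 <= f x <= 1)%E -> (forall x, 0 <= g x <= 1)%E ->
  (forall x, 0 <= h x)%E ->
  (forall x : R, B < `|x| -> f x = 0%E) -> (forall x : R, B < `|x| -> g x = 0%E) ->
  (forall t : R, t < 1 -> exists x, (t%:E < f x)%E) ->
  (forall t : R, t < 1 -> exists x, (t%:E < g x)%E) ->
  (forall x y : R, (f x * g y <= h ((x + y) / 2)%R * h ((x + y) / 2)%R)%E) ->
  (\int[@lebesgue_measure R]_x f x + \int[@lebesgue_measure R]_x g x <=
   2%:E * \int[@lebesgue_measure R]_x h x)%E.
Proof.
move=> mf mg mh f01 g01 h0 fB gB fsup gsup fgh.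
have f0 x : (0 <= f x)%E by have /andP[] := f01 x.
have g0 x : (0 <= g x)%E by have /andP[] := g01 x.
have cake (k : R -> \bar R) : measurable_fun setT k ->
    (forall x, 0 <= k x <= 1)%E ->
    (\int[@lebesgue_measure R]_x k x =
    \int[@lebesgue_measure R]_(t in `]0%R, 1%R[)
      lebesgue_measure [set x | t%:E < k x])%E.
  move=> mk k01; rewrite layer_cake_unit//; last by move=> x; case/andP: (k01 x).
  by apply: eq_integral => x _; rewrite min_l//; case/andP: (k01 x).
have ms := @measurable_superlevel_mass R _ _ (@lebesgue_measure R).
have mD : measurable (`]0%R, 1%R[%classic : set (measurableTypeR R)).
  exact: measurable_itv.
have mlev (k : R -> \bar R) t : measurable_fun setT k ->
    measurable [set x | (t%:E < k x)%E].
  by move=> mk; rewrite -[X in measurable X]setTI; apply: measurable_lte.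
have levfin (k : R -> \bar R) t : 0 < t -> measurable_fun setT k ->
    (forall x : R, B < `|x| -> k x = 0%E) ->
    (lebesgue_measure [set x | (t%:E < k x)%E] < +oo)%E.
  move=> t0 mk kB.
  apply: (@le_lt_trans _ _ (lebesgue_measure `[-B, B]%classic)).
    rewrite le_measure ?inE//; first exact: mlev.
    move=> x /= tk; rewrite in_itv/= -ler_norml leNgt; apply/negP => /kB kx.
    by move: tk; rewrite kx lte_fin ltNge ltW.
  by rewrite lebesgue_measure_itv/=; case: ifP => // _; rewrite ltry.
rewrite (cake f)// (cake g)// -ge0_integralD//=; last 2 first.
- exact: measurable_funS (ms _ mf).
- exact: measurable_funS (ms _ mg).
apply: (@le_trans _ _ (\int[@lebesgue_measure R]_(t in `]0%R, 1%R[)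
      (2%:E * lebesgue_measure [set x | t%:E < h x]))%E).
  apply: ge0_le_integral => //=.
  - by move=> x _; rewrite adde_ge0.
  - by apply: emeasurable_funD; [exact: measurable_funS (ms _ mf)|
      exact: measurable_funS (ms _ mg)].
  - by apply: emeasurable_funM => //; exact: measurable_funS (ms _ mh).
  move=> t; rewrite /= in_itv/= => /andP[t0 t1].
  apply: brunn_minkowski_line => //; try exact: mlev; try exact: fsup; try exact: gsup; try exact: levfin.
  (* If h were at most t at the midpoint, its square would be at most t * t, which is smaller than f
     x * g y. *)
  move=> x y /= tf tg; rewrite ltNge; apply/negP => ht.
  have : (t%:E * t%:E < f x * g y)%E by apply: lte_pmul; rewrite ?lee_fin ?ltW.
  rewrite ltNge => /negP; apply; apply: (le_trans (fgh x y)).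
  exact: lee_pmul.
rewrite ge0_integralZl//; last exact: measurable_funS (ms _ mh).
(* Since h may exceed 1, the levels in ]0, 1[ yield the integral of min(h, 1), which is at most that
   of h. *)
rewrite lee_wpmul2l// layer_cake_unit//.
apply: ge0_le_integral => //.
- by move=> x _; rewrite le_min h0/=.
- exact: measurable_mine.
- by move=> x _; rewrite ge_min lexx.
Qed.

(** Dividing f and g by their suprema a and b, and h by sqrt(a b), reduces to the normalised case.
    The arithmetic-geometric mean inequality then turns its additive conclusion into the product
    form. *)
Lemma prekopa_leindler_line (R : realType) (f g h : R -> \bar R) (B M : R) :
  measurable_fun setT f -> measurable_fun setT g -> measurable_fun setT h ->
  (forall x, 0 <= f x <= M%:E)%E -> (forall x, 0 <= g x <= M%:E)%E ->
  (forall x, 0 <= h x)%E ->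
  (forall x, B < `|x| -> f x = 0%E) -> (forall x, B < `|x| -> g x = 0%E) ->
  (forall x y : R, (f x * g y <= h ((x + y) / 2)%R * h ((x + y) / 2)%R)%E) ->
  (\int[@lebesgue_measure R]_x f x * \int[@lebesgue_measure R]_x g x <=
   \int[@lebesgue_measure R]_x h x * \int[@lebesgue_measure R]_x h x)%E.
Proof.
move=> mf mg mh fM gM h0 fB gB fgh.
set If := (\int[@lebesgue_measure R]_x f x)%E; set Ig := (\int[@lebesgue_measure R]_x g x)%E.
set Ih := (\int[@lebesgue_measure R]_x h x)%E.
have Ih0 : (0 <= Ih)%E by exact: integral_ge0.
have f0 x : (0 <= f x)%E by have /andP[] := fM x.
have g0 x : (0 <= g x)%E by have /andP[] := gM x.
have If0 : (0 <= If)%E by exact: integral_ge0.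
have Ig0 : (0 <= Ig)%E by exact: integral_ge0.
have supP (k : R -> \bar R) : (forall x, 0 <= k x <= M%:E)%E ->
    exists2 a : R, ereal_sup (range k) = a%:E & 0 <= a.
  move=> kM; have k0 := kM 0.
  have s0 : (0 <= ereal_sup (range k))%E.
    by apply: (@le_trans _ _ (k 0)); [case/andP: k0|apply: ereal_sup_ubound; exists 0].
  have sM : (ereal_sup (range k) <= M%:E)%E.
    by apply: ge_ereal_sup => _ [x _ <-]; case/andP: (kM x).
  move: s0 sM; case: (ereal_sup _) => [a| |]//; rewrite ?leNye// => a0 _.
  by exists a.
have [a supf a0] := supP f fM; have [b supg b0] := supP g gM.
have lef x : (f x <= a%:E)%E by rewrite -supf; apply: ereal_sup_ubound; exists x.
have leg x : (g x <= b%:E)%E by rewrite -supg; apply: ereal_sup_ubound; exists x.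
have [az|an0] := eqVneq a 0.
  rewrite [If]integral0_eq ?mul0e; first exact: mule_ge0.
  by move=> x _; apply/eqP; rewrite eq_le f0 andbT; have := lef x; rewrite az.
have [bz|bn0] := eqVneq b 0.
  rewrite [Ig]integral0_eq ?mule0; first exact: mule_ge0.
  by move=> x _; apply/eqP; rewrite eq_le g0 andbT; have := leg x; rewrite bz.
have ap : 0 < a by rewrite lt_def an0.
have bp : 0 < b by rewrite lt_def bn0.
pose c := Num.sqrt (a * b).
have cp : 0 < c by rewrite sqrtr_gt0 mulr_gt0.
have c2 : c * c = a * b by rewrite -expr2 sqr_sqrtr// mulr_ge0.
have key : ((a^-1)%:E * If + (b^-1)%:E * Ig <= 2%:E * ((c^-1)%:E * Ih))%E.
  have scale (k : R -> \bar R) r : measurable_fun setT k -> (forall x, 0 <= k x)%E ->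
      0 < r -> ((r^-1)%:E * \int[@lebesgue_measure R]_x k x =
      \int[@lebesgue_measure R]_x ((r^-1)%:E * k x))%E.
    by move=> mk k0 r0; rewrite ge0_integralZl// lee_fin invr_ge0 ltW.
  rewrite /If /Ig /Ih !scale//.
  apply: (@prekopa_leindler_sup1 R _ _ _ B).
  - exact: emeasurable_funM.
  - exact: emeasurable_funM.
  - exact: emeasurable_funM.
  - move=> x; rewrite mule_ge0 ?lee_fin ?invr_ge0 ?(ltW ap)//=.
    by rewrite -(@mulVf _ a)// EFinM lee_wpmul2l// lee_fin invr_ge0.
  - move=> x; rewrite mule_ge0 ?lee_fin ?invr_ge0 ?(ltW bp)//=.
    by rewrite -(@mulVf _ b)// EFinM lee_wpmul2l// lee_fin invr_ge0.
  - by move=> x; rewrite mule_ge0 ?lee_fin ?invr_ge0 ?(ltW cp).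
  - by move=> x /fB ->; rewrite mule0.
  - by move=> x /gB ->; rewrite mule0.
  - move=> t t1; have : ((a * t)%:E < ereal_sup (range f))%E.
      by rewrite supf lte_fin gtr_pMr.
    move=> /ereal_sup_gt[_ [x _ <-]] fx; exists x.
    by rewrite -(@mulKf _ a _ t)// EFinM lte_pmul2l// lte_fin invr_gt0.
  - move=> t t1; have : ((b * t)%:E < ereal_sup (range g))%E.
      by rewrite supg lte_fin gtr_pMr.
    move=> /ereal_sup_gt[_ [x _ <-]] gx; exists x.
    by rewrite -(@mulKf _ b _ t)// EFinM lte_pmul2l// lte_fin invr_gt0.
  - move=> x y; rewrite muleACA [leRHS]muleACA -!EFinM -!invfM c2.
    by rewrite lee_wpmul2l// lee_fin invr_ge0 mulr_ge0.
have [Ihoo|Ihfin] := eqVneq Ih +oo%E; first by rewrite Ihoo mulyy leey.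
move: key Ih0 Ihfin If0 Ig0; clearbody If Ig Ih.
have ai : 0 < a^-1 by rewrite invr_gt0.
have bi : 0 < b^-1 by rewrite invr_gt0.
case: Ih => [s| |]// + s0 _; case: If => [p| |]// + p0; last first.
  by rewrite gt0_muley ?lte_fin// -!EFinM; case: Ig => [q| |]//=;
    rewrite ?gt0_muley ?lte_fin.
case: Ig => [q| |]//; last by rewrite gt0_muley ?lte_fin// -!EFinM.
rewrite -!EFinM -EFinD !lee_fin => key q0; rewrite !lee_fin in s0 p0 q0.
have pE : p = a * (a^-1 * p) by rewrite mulVKf.
have qE : q = b * (b^-1 * q) by rewrite mulVKf.
have sE : s = c * (c^-1 * s) by rewrite mulVKf ?gt_eqF.
rewrite pE qE sE mulrACA [leRHS]mulrACA c2 ler_wpM2l ?mulr_ge0 ?(ltW ap) ?(ltW bp)//.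
have u0 : 0 <= a^-1 * p by rewrite mulr_ge0// ltW.
have v0 : 0 <= b^-1 * q by rewrite mulr_ge0// ltW.
move: key; move: (a^-1 * p) (b^-1 * q) (c^-1 * s) u0 v0 => u v w u0 v0 key.
(* From u + v <= 2 w: 4 w^2 >= (u + v)^2 = (u - v)^2 + 4 u v. *)
have h1 : 0 <= (2 * w - (u + v)) * (2 * w + (u + v)) by apply: mulr_ge0; lra.
have h2 := sqr_ge0 (u - v).
rewrite !expr2 in h2; lra.
Qed.

(** * The measure [lebesgue_tuple] and the Prekopa-Leindler inequality *)

Lemma behead_tuple_cons (T : Type) (n : nat) (x : T) (t : n.-tuple T) :
  [tuple of behead [tuple of x :: t]] = t.
Proof. exact/val_inj. Qed.

Lemma measurable_tuple_cons (R : realType) (n : nat) :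
  measurable_fun setT (fun p : measurableTypeR R * n.-tuple (measurableTypeR R) =>
    [tuple of p.1 :: p.2]).
Proof. by apply: measurable_cons; [exact: measurable_fst|exact: measurable_snd]. Qed.

(** The product with the next factor requires a sigma-finite measure, so the induction has to carry
    this structure along with the set function. *)
Lemma lebesgue_tuple_is_measure (R : realType) (n : nat) :
  exists m : {sigma_finite_measure set (n.-tuple (measurableTypeR R)) -> \bar R},
    @lebesgue_tuple R n = m :> (set _ -> \bar R).
Proof.
elim: n => [|n [m IH]].
  by exists (dirac [tuple] : {sigma_finite_measure set _ -> \bar R}).
pose mu := measure_function_pushforward__canonical__measure_function_Measure
  (@lebesgue_measure R \x m)%E (@measurable_tuple_cons R n).
have sf : sigma_finite setT mu.
  have /sigma_finiteP[F [FT ndF Ffin]] := sigma_finiteT (@lebesgue_measure R).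
  have /sigma_finiteP[G [GT ndG Gfin]] := sigma_finiteT m.
  pose u (s : n.+1.-tuple (measurableTypeR R)) := (thead s, [tuple of behead s]).
  have mu_ : measurable_fun setT u.
    apply: measurable_fun_pair; last exact: measurable_behead.
    exact: measurable_tnth.
  exists (fun k => u @^-1` (F k `*` G k)).
    rewrite -preimage_bigcup; apply/seteqP; split => // s _ /=.
    have [i _ Fi] : (\bigcup_i F i) (u s).1 by rewrite -FT.
    have [j _ Gj] : (\bigcup_i G i) (u s).2 by rewrite -GT.
    (* Both exhaustions are increasing, so the larger index serves both coordinates. *)
    exists (maxn i j) => //; split.
      by move: Fi; exact/subsetPset/ndF/leq_maxl.
    by move: Gj; exact/subsetPset/ndG/leq_maxr.
  move=> k; have [mF Fk] := Ffin k; have [mG Gk] := Gfin k; split.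
    by rewrite -[X in measurable X]setTI; apply: mu_ => //; exact: measurableX.
  rewrite /mu /= /pushforward [X in ((_ \x _) X)%E](_ : _ = F k `*` G k); last first.
    by apply/seteqP; split => -[x t] /=; rewrite /u theadE behead_tuple_cons.
  by rewrite product_measure1E// lte_mul_pinfty// ge0_fin_numE.
pose mix := Measure_isSigmaFinite.Build _ _ _ mu sf.
pose ms : {sigma_finite_measure set _ -> \bar R} :=
  HB.pack (Measure.sort mu) (Measure.class mu) mix.
by exists ms; rewrite /= IH.
Qed.

Section lebesgue_tuple_measure.
Variables (R : realType) (n : nat).

Let lebesgue_tuple0 : @lebesgue_tuple R n set0 = 0%E.
Proof. by have [m ->] := lebesgue_tuple_is_measure R n; exact: measure0. Qed.

Let lebesgue_tuple_ge0 A : (0 <= @lebesgue_tuple R n A)%E.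
Proof. by have [m ->] := lebesgue_tuple_is_measure R n; exact: measure_ge0. Qed.

Let lebesgue_tuple_semi_sigma_additive : semi_sigma_additive (@lebesgue_tuple R n).
Proof.
by have [m ->] := lebesgue_tuple_is_measure R n; exact: measure_semi_sigma_additive.
Qed.

HB.instance Definition _ := isMeasure.Build _ _ _ (@lebesgue_tuple R n)
  lebesgue_tuple0 lebesgue_tuple_ge0 lebesgue_tuple_semi_sigma_additive.

Let lebesgue_tuple_sigma_finite : sigma_finite setT (@lebesgue_tuple R n).
Proof. by have [m ->] := lebesgue_tuple_is_measure R n; exact: sigma_finiteT. Qed.

HB.instance Definition _ := Measure_isSigmaFinite.Build _ _ _
  (@lebesgue_tuple R n) lebesgue_tuple_sigma_finite.

End lebesgue_tuple_measure.

Lemma ge0_integral_tuple_cons (R : realType) (n : nat)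
    (f : n.+1.-tuple (measurableTypeR R) -> \bar R) :
  measurable_fun setT f -> (forall s, 0 <= f s)%E ->
  (\int[@lebesgue_tuple R n.+1]_s f s =
   \int[@lebesgue_measure R]_x \int[@lebesgue_tuple R n]_t f [tuple of x :: t])%E.
Proof.
move=> mf f0.
rewrite /= ge0_integral_pushforward//=; last exact: measurable_tuple_cons.
rewrite preimage_setT fubini_tonelli1//.
by apply: measurableT_comp => //; exact: measurable_tuple_cons.
Qed.

Lemma tnth_consP (T : Type) (n : nat) (P : 'I_n.+1 -> T -> Prop) (x : T) (t : n.-tuple T) :
  (forall i, P i (tnth [tuple of x :: t] i)) <->
  P ord0 x /\ forall j : 'I_n, P (lift ord0 j) (tnth t j).
Proof.
split=> [H|[H0 HS] i].
  by split=> [|j]; [have := H ord0; rewrite tnth0|have := H (lift ord0 j); rewrite tnthS].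
by case: (unliftP ord0 i) => [j|] ->; rewrite ?tnthS ?tnth0.
Qed.

Lemma measurable_tuple_box (R : realType) (n : nat) (A : 'I_n -> set R) :
  (forall i, measurable (A i)) ->
  measurable [set s : n.-tuple (measurableTypeR R) | forall i, A i (tnth s i)].
Proof.
move=> mA.
rewrite [X in measurable X](_ : _ = \bigcap_(i in [set: 'I_n])
    ((fun s : n.-tuple (measurableTypeR R) => tnth s i) @^-1` A i)).
  apply: fin_bigcap_measurable => // i _.
  by rewrite -[X in measurable X]setTI; apply: measurable_tnth => //; exact: mA.
apply/seteqP; split => s /= H i; first by move=> _; exact: H.
exact: H.
Qed.

Lemma lebesgue_tuple_ball (R : realType) (n : nat) (c : 'I_n -> R) (e : R) : 0 < e ->
  @lebesgue_tuple R n [set s | forall i, ball (c i) e (tnth s i : R)] =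
  ((2 * e) ^+ n)%:E.
Proof.
move=> e0; elim: n c => [|n IH] c.
  by rewrite /= diracE mem_set// => -[].
rewrite /= /pushforward.
rewrite [X in ((_ \x _) X)%E](_ : _ = ball (c ord0) e `*`
    [set t | forall i, ball (c (lift ord0 i)) e (tnth t i : R)]); last first.
  apply/seteqP; split => -[x t] /=.
    by move/(tnth_consP (fun i (y : measurableTypeR R) => ball (c i) e (y : R))).
  by move=> ?; apply/(tnth_consP (fun i (y : measurableTypeR R) => ball (c i) e (y : R))).
rewrite product_measure1E//.
- transitivity ((e *+ 2)%:E * ((2 * e) ^+ n)%:E)%E.
    congr (_ * _)%E; first exact: (lebesgue_measure_ball _ (ltW e0)).
    exact: (IH (fun i => c (lift ord0 i))).
  by rewrite -EFinM exprS mulr_natl.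
- exact: measurable_ball.
- apply: (@measurable_tuple_box R n (fun i => ball (c (lift ord0 i)) e)) => i.
  exact: measurable_ball.
Qed.

Definition tuple_mid (R : realType) (n : nat) (s t : n.-tuple (measurableTypeR R)) :
    n.-tuple (measurableTypeR R) :=
  [tuple ((tnth s i : R) + tnth t i) / 2 | i < n].

Lemma tuple_mid_cons (R : realType) (n : nat) (x y : R) (s t : n.-tuple (measurableTypeR R)) :
  tuple_mid [tuple of (x : measurableTypeR R) :: s] [tuple of (y : measurableTypeR R) :: t] =
  [tuple of ((x + y) / 2 : measurableTypeR R) :: tuple_mid s t].
Proof.
apply: eq_from_tnth => i; rewrite tnth_mktuple.
by case: (unliftP ord0 i) => [j|] ->; rewrite ?tnthS ?tnth0// tnth_mktuple.
Qed.

(** Induction on the dimension. For fixed first coordinates x and y, the induction hypothesis on the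
    sections is exactly the pointwise hypothesis of the one-dimensional inequality for the section
    integrals. *)
Lemma prekopa_leindler (R : realType) (n : nat)
    (f g h : n.-tuple (measurableTypeR R) -> \bar R) (B M : R) :
  0 <= B -> 0 <= M ->
  measurable_fun setT f -> measurable_fun setT g -> measurable_fun setT h ->
  (forall s, 0 <= f s <= M%:E)%E -> (forall s, 0 <= g s <= M%:E)%E ->
  (forall s, 0 <= h s)%E ->
  (forall s i, B < `|tnth s i : R| -> f s = 0%E) ->
  (forall s i, B < `|tnth s i : R| -> g s = 0%E) ->
  (forall s t, f s * g t <= h (tuple_mid s t) * h (tuple_mid s t))%E ->
  (\int[@lebesgue_tuple R n]_s f s * \int[@lebesgue_tuple R n]_s g s <=
   \int[@lebesgue_tuple R n]_s h s * \int[@lebesgue_tuple R n]_s h s)%E.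
Proof.
move=> B0; elim: n f g h M => [|n IH] f g h M M0 mf mg mh fM gM h0 fB gB fgh.
  rewrite /= !integral_dirac// !diracT !mul1e.
  by have := fgh [tuple] [tuple]; rewrite (_ : tuple_mid _ _ = [tuple])// tuple0.
have pos (k : n.+1.-tuple (measurableTypeR R) -> \bar R) :
  (forall s, 0 <= k s <= M%:E)%E -> forall s, (0 <= k s)%E.
  by move=> kM s; case/andP: (kM s).
have f0 := pos _ fM; have g0 := pos _ gM.
have msec (k : n.+1.-tuple (measurableTypeR R) -> \bar R) (x : R) :
    measurable_fun setT k ->
    measurable_fun setT (fun t : n.-tuple (measurableTypeR R) => k [tuple of (x : measurableTypeR R) :: t]).
  move=> mk; apply: measurableT_comp => //.
  by apply: (@measurable_cons _ _ (n.-tuple (measurableTypeR R)) (measurableTypeR R)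
    (cst (x : measurableTypeR R)) n id).
have mint (k : n.+1.-tuple (measurableTypeR R) -> \bar R) : measurable_fun setT k ->
    (forall s, 0 <= k s)%E ->
    measurable_fun setT (fun x : measurableTypeR R =>
      \int[@lebesgue_tuple R n]_t k [tuple of x :: t])%E.
  move=> mk k0.
  apply: (@measurable_fun_fubini_tonelli_F _ _ _ _ R (@lebesgue_tuple R n)
     (fun p : measurableTypeR R * n.-tuple (measurableTypeR R) => k [tuple of p.1 :: p.2])) => //.
  by apply: measurableT_comp => //; exact: measurable_tuple_cons.
(* Volume of an open cube containing the support of every section; the section integrals are thus
   bounded by [M * N]. *)
pose N := (2 * (B + 1)) ^+ n.
have N0 : 0 <= N by rewrite exprn_ge0// mulr_ge0// addr_ge0.
have bnd (k : n.+1.-tuple (measurableTypeR R) -> \bar R) (x : R) :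
    measurable_fun setT k -> (forall s, 0 <= k s <= M%:E)%E ->
    (forall s i, B < `|tnth s i : R| -> k s = 0%E) ->
    (0 <= \int[@lebesgue_tuple R n]_t k [tuple of (x : measurableTypeR R) :: t] <= (M * N)%:E)%E.
  move=> mk kM kB; have k0 := pos _ kM; apply/andP; split; first exact: integral_ge0.
  pose box := [set s : n.-tuple (measurableTypeR R) | forall i, ball (0 : R) (B + 1) (tnth s i : R)].
  have mbox : measurable box by apply: (@measurable_tuple_box R n (fun=> ball 0 (B + 1))) => i; exact: measurable_ball.
  apply: (@le_trans _ _ (\int[@lebesgue_tuple R n]_t (M%:E * (\1_box t)%:E))%E).
    apply: ge0_le_integral => //.
    - exact: msec.
    - apply: emeasurable_funM => //; apply/measurable_EFinP; exact: measurable_indic.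
    move=> t _; rewrite indicE; have [tb|tb] := boolP (t \in box).
      by rewrite mule1; case/andP: (kM [tuple of (x : measurableTypeR R) :: t]).
    rewrite mule0; move: tb; rewrite notin_setE => /existsNP[i ti].
    rewrite (kB _ (lift ord0 i))// tnthS ltNge; apply/negP => tiB; apply: ti.
    by rewrite /ball/= sub0r normrN (le_lt_trans tiB)// ltrDl.
  rewrite ge0_integralZl//; last by apply/measurable_EFinP; exact: measurable_indic.
  rewrite integral_indic// setIT EFinM lee_wpmul2l ?lee_fin//.
  by rewrite -(lebesgue_tuple_ball (fun=> 0)) ?ltr_wpDl.
rewrite !ge0_integral_tuple_cons//.
apply: (@prekopa_leindler_line R _ _ _ B (M * N)).
- exact: mint.
- exact: mint.
- exact: mint.
- by move=> x; exact: bnd.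
- by move=> x; exact: bnd.
- by move=> x; exact: integral_ge0.
- by move=> x xB; rewrite integral0_eq// => t _; rewrite (fB _ ord0)// tnth0.
- by move=> x xB; rewrite integral0_eq// => t _; rewrite (gB _ ord0)// tnth0.
move=> x y; apply: (IH _ _ _ M) => //; try exact: msec.
- by move=> s i si; rewrite (fB _ (lift ord0 i))// tnthS.
- by move=> s i si; rewrite (gB _ (lift ord0 i))// tnthS.
- by move=> s t; rewrite -tuple_mid_cons; exact: fgh.
Qed.

(** * Log-concave superlevel masses *)

(** The ratios of consecutive terms of a log-concave sequence decrease, so the geometric sequence
    through the terms m and m + 1 dominates it on both sides. The factor r^(m + 1) is moved to the
    left to avoid negative exponents. *)
Lemma log_concave_seq_geometric (R : realType) (u : nat -> R) (m : nat) :
  (forall i, 0 <= u i) -> (forall i, u i.+1 <= u i) ->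
  (forall i, u i * u i.+2 <= u i.+1 * u i.+1) -> 0 < u m.+1 ->
  forall i, u i * (u m.+1 / u m) ^+ m.+1 <= u m.+1 * (u m.+1 / u m) ^+ i.
Proof.
move=> u0 umono ulog um.
have ump : 0 < u m by exact: lt_le_trans um (umono m).
have upos k : (k <= m.+1)%N -> 0 < u k.
  move=> km; apply: (lt_le_trans um).
  by rewrite -(subnKC km); elim: (m.+1 - k)%N => [|j IH]; rewrite ?addn0// addnS (le_trans (umono _)).
set r := u m.+1 / u m.
have r0 : 0 < r by rewrite divr_gt0.
have fwd k : u (m.+1 + k)%N <= r * u (m + k)%N.
  elim: k => [|k IH]; first by rewrite !addn0 /r divfK// gt_eqF.
  rewrite !addnS addSn in IH *.
  have := ulog (m + k)%N.
  (* A vanishing term forces the following ones to vanish, so dividing by it is avoided. *)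
  have [z|nz] := eqVneq (u (m + k)%N) 0.
    move=> _; have : u (m + k).+1 <= 0 by rewrite (le_trans IH)// z mulr0.
    by move=> h; rewrite (le_trans (umono _))// (le_trans h)// mulr_ge0// ltW.
  have p : 0 < u (m + k)%N by rewrite lt_def nz u0.
  move=> h; rewrite -(ler_pM2l p) (le_trans h)//.
  have := ler_wpM2r (u0 (m + k).+1) IH; lra.
have bwd k : (k <= m)%N -> r * u (m - k)%N <= u (m - k).+1.
  elim: k => [|k IH] km; first by rewrite subn0 /r divfK// gt_eqF.
  have {}IH := IH (ltnW km).
  have e : (m - k = (m - k.+1).+1)%N by rewrite subnSK.
  rewrite e in IH; set j := (m - k.+1)%N in IH *.
  have p2 : 0 < u j.+2.
    by apply: upos; rewrite /j -e ltnS leq_subr.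
  have p1 : 0 < u j.+1 by exact: lt_le_trans p2 (umono _).
  rewrite -(ler_pM2r p2); have := ulog j.
  move=> h; have := ler_wpM2l (ltW r0) h; move=> {}h.
  rewrite -mulrA (le_trans h)// mulrA.
  by rewrite [leRHS]mulrC ler_wpM2r// ltW.
move=> i; have [im|im] := leqP m.+1 i.
  rewrite -(subnKC im); elim: (i - m.+1)%N => [|k IH]; first by rewrite addn0.
  rewrite addnS [in leRHS]exprS; have := fwd k.+1; rewrite !addnS addSn in IH * => h.
  have h2 := ler_wpM2r (exprn_ge0 m.+1 (ltW r0)) h; have h1 := ler_wpM2l (ltW r0) IH.
  by rewrite mulrCA; apply: le_trans h1; rewrite mulrA.
have -> : i = (m.+1 - (m.+1 - i))%N by rewrite subKn// ltnW.
have : (m.+1 - i <= m.+1)%N by rewrite leq_subr.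
elim: (m.+1 - i)%N => [|k IH] km; first by rewrite subn0.
have {}IH := IH (ltnW km); have h := bwd k km.
rewrite subSS; rewrite (subSn (km : k <= m)%N) [in leRHS]exprS in IH.
rewrite -(ler_pM2l r0).
have := ler_wpM2r (exprn_ge0 m.+1 (ltW r0)) h.
by rewrite -mulrA => /le_trans; apply; rewrite mulrCA.
Qed.

(** The right-hand side rounds y up on the grid of step h that starts at - m h. Integrated, it
    bounds a mean by a sum of superlevel masses. *)
Lemma staircase_bound (R : realType) (h y : R) (m n : nat) : 0 < h -> y < (n%:R - m%:R) * h ->
  y <= - (m%:R * h) + \sum_(i < n) h * ((i%:R - m%:R) * h <= y)%R%:R.
Proof.
move=> h0; elim: n => [|n IH] yn.
  by rewrite big_ord0 addr0; apply: ltW; move: yn; rewrite sub0r mulNr.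
rewrite big_ord_recr/=; have [ny|ny] := leP ((n%:R - m%:R) * h) y.
  rewrite mulr1 (eq_bigr (fun=> h)).
    by rewrite sumr_const card_ord -mulr_natl; move: yn; rewrite -natr1; lra.
  move=> i _; rewrite (_ : _ <= _) ?mulr1//.
  by apply: le_trans ny; rewrite ler_pM2r// lerD2r ler_nat ltnW.
by rewrite mulr0 addr0; exact: IH.
Qed.

Lemma bounded_integrable (R : realType) dd (T : measurableType dd)
    (mu : {measure set T -> \bar R}) (D : set T) (f : T -> R) (M : R) :
  measurable D -> (mu D < +oo)%E -> measurable_fun setT f ->
  (forall s, D s -> `|f s| <= M) -> mu.-integrable D (EFin \o f).
Proof.
move=> mD Dfin mf fM; apply: measurable_bounded_integrable => //.
  exact: measurable_funS mf.
exists M; split; first exact: num_real.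
by move=> x Mx s Ds /=; apply: (le_trans (fM s Ds)); exact: ltW.
Qed.

Section superlevel_masses.
Variables (R : realType) (dd : measure_display) (T : measurableType dd).
Variables (mu : {measure set T -> \bar R}) (D : set T) (Y : T -> R) (B : R).
Hypotheses (mD : measurable D) (D0 : (0 < mu D)%E) (Dfin : (mu D < +oo)%E).
Hypotheses (mY : measurable_fun setT Y) (YB : forall s, D s -> `|Y s| <= B).

Let E t := D `&` [set s | t <= Y s].
Let G t := fine (mu (E t)).
Let V := fine (mu D).

Let mS t : measurable [set s | t <= Y s].
Proof.
rewrite (_ : [set s | _] = setT `&` Y @^-1` `[t, +oo[%classic).
  by apply: mY => //; exact: measurable_itv.
by apply/seteqP; split => s /=; rewrite in_itv/= andbT; [|case].
Qed.

Let mE t : measurable (E t). Proof. exact: measurableI. Qed.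

Let VE : mu D = V%:E.
Proof. by rewrite fineK// ge0_fin_numE. Qed.

Let V0 : 0 < V. Proof. by rewrite -lte_fin -VE. Qed.

Let GE t : mu (E t) = (G t)%:E.
Proof.
rewrite fineK// ge0_fin_numE// (le_lt_trans _ Dfin)// le_measure ?inE//.
exact: subIsetl.
Qed.

Let G0 t : 0 <= G t. Proof. exact: fine_ge0. Qed.

Let Gmono t t' : t <= t' -> G t' <= G t.
Proof.
move=> tt'; rewrite -lee_fin -!GE le_measure ?inE// => s [Ds /= ts]; split => //=.
exact: le_trans ts.
Qed.

Let Gfull t : t <= - B -> G t = V.
Proof.
move=> tB; rewrite /G /V /E setIidl// => s Ds /=; apply: (le_trans tB).
by have := YB Ds; rewrite ler_norml => /andP[].
Qed.

Let ind_bool t s : \1_[set s | t <= Y s] s = (t <= Y s)%R%:R :> R.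
Proof. by rewrite indicE; congr (nat_of_bool _)%:R; apply/idP/idP; rewrite inE. Qed.

Let integrable_step t : mu.-integrable D (EFin \o (fun s => (t <= Y s)%R%:R : R)).
Proof.
apply: (@bounded_integrable _ _ _ _ _ _ 1) => //.
  rewrite (_ : (fun s => _) = \1_[set s | t <= Y s]); first exact: measurable_indic.
  by apply/funext => s; rewrite ind_bool.
by move=> s _; case: (t <= Y s); rewrite /= ?normr1 ?normr0.
Qed.

Lemma Rintegral_step t : \int[mu]_(s in D) ((t <= Y s)%R%:R : R) = G t.
Proof.
rewrite /Rintegral /G /E setIC -integral_indic//; congr fine.
by apply: eq_integral => s _; rewrite ind_bool.
Qed.

(** Induction on the number of steps; integrability is carried along because linearity of the
    real-valued integral requires it. *)
Lemma Rintegral_steps (c : R) (n : nat) (a t : nat -> R) :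
  mu.-integrable D (EFin \o (fun s => c + \sum_(i < n) a i * (t i <= Y s)%R%:R)) /\
  \int[mu]_(s in D) (c + \sum_(i < n) a i * (t i <= Y s)%R%:R) =
    c * V + \sum_(i < n) a i * G (t i).
Proof.
pose F n s : R := c + \sum_(i < n) a i * (t i <= Y s)%R%:R.
rewrite -[fun s => _]/(F n) -/(Rintegral _ _ (F n)).
elim: n => [|n [intn eqn]].
  rewrite (_ : F 0%N = cst c); last by apply/funext => s; rewrite /F big_ord0 addr0.
  rewrite big_ord0 addr0 Rintegral_cst//; split => //.
  exact: (@bounded_integrable _ _ _ _ _ _ `|c|).
rewrite (_ : F n.+1 = fun s => F n s + a n * (t n <= Y s)%R%:R); last first.
  by apply/funext => s; rewrite /F big_ord_recr/= addrA.
have intZ : mu.-integrable D (EFin \o (fun s => a n * (t n <= Y s)%R%:R)).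
  exact: (integrableZl mD (a n) (integrable_step (t n))).
split; first exact: (integrableD mD intn intZ).
rewrite RintegralD// eqn RintegralZl//.
by rewrite Rintegral_step big_ord_recr/= addrA.
Qed.

Let integrableY : mu.-integrable D (EFin \o Y).
Proof. exact: (@bounded_integrable _ _ _ _ _ _ B). Qed.

Lemma Rintegral_le_steps (c : R) (n : nat) (a t : nat -> R) :
  (forall s, D s -> Y s <= c + \sum_(i < n) a i * (t i <= Y s)%R%:R) ->
  \int[mu]_(s in D) Y s <= c * V + \sum_(i < n) a i * G (t i).
Proof.
by move=> Yle; have [int <-] := Rintegral_steps c n a t; exact: le_Rintegral.
Qed.

(** Left continuity of [G] at 0: the sets [E] at -1/(k + 1) decrease to [E 0]. *)
Lemma superlevel_mass_lt (e : R) : 0 < e -> exists2 h, 0 < h & G (- h) < G 0 + e.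
Proof.
move=> e0; pose F k := E (- k.+1%:R^-1).
have F0 : \bigcap_k F k = E 0.
  apply/seteqP; split => s /=.
    move=> H; split; first by have [] := H 0%N I.
    rewrite /= leNgt; apply/negP => Ys.
    have /(_ (- Y s)) := @ltr_add_invr R 0; rewrite oppr_gt0 => /(_ Ys)[k].
    rewrite add0r => hk; have [_ /=] := H k I; rewrite leNgt => /negP; apply.
    by rewrite ltrNr.
  by move=> [Ds /= Ys] k _; split => //=; rewrite (le_trans _ Ys)// oppr_le0 invr_ge0.
have : (mu \o F) x @[x --> \oo] --> mu (\bigcap_k F k).
  apply: nonincreasing_cvg_mu => //.
  - by rewrite GE ltry.
  - by move=> k; exact: mE.
  - by rewrite F0; exact: mE.
  - move=> i j ij; apply/subsetPset => s [Ds /= Ys]; split => //=.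
    by apply: le_trans Ys; rewrite lerN2 lef_pV2 ?posrE// ler_nat ltnS.
rewrite F0 GE (_ : mu \o F = EFin \o (fun k => G (- k.+1%:R^-1))); last first.
  by apply/funext => k /=; rewrite GE.
move=> /fine_cvgP[_] /= cvgG.
have : \forall k \near \oo, G (- k.+1%:R^-1) < G 0 + e.
  by apply: (cvgr_lt _ cvgG); rewrite ltrDl.
move=> [N _ HN]; exists N.+1%:R^-1; first by rewrite invr_gt0.
exact: (HN N (leqnn N)).
Qed.

(** Midpoint log-concavity of [G], the form in which Brunn-Minkowski enters the bounds below. *)
Hypothesis Elog : forall a b,
  (mu (E a) * mu (E b) <= mu (E ((a + b) / 2)%R) * mu (E ((a + b) / 2)%R))%E.

Let Glog a b : G a * G b <= G ((a + b) / 2) * G ((a + b) / 2).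
Proof. by have := Elog a b; rewrite !GE -!EFinM lee_fin. Qed.

Let progression (a h : R) (u := fun i : nat => G (a + i%:R * h)) : 0 < h ->
  [/\ forall i, 0 <= u i, forall i, u i.+1 <= u i &
      forall i, u i * u i.+2 <= u i.+1 * u i.+1].
Proof.
move=> h0; split => i; rewrite /u; first exact: G0.
  by apply: Gmono; rewrite lerD2l ler_pM2r// ler_nat.
rewrite (_ : a + i.+1%:R * h = ((a + i%:R * h) + (a + i.+2%:R * h)) / 2)//.
by rewrite -[i.+2]addn2 -[i.+1]addn1 !natrD; lra.
Qed.

Let B0 : 0 <= B.
Proof.
have [s Ds] : D !=set0.
  by apply/set0P; apply/eqP => D00; move: D0; rewrite D00 measure0 ltxx.
exact: le_trans (YB Ds).
Qed.

Let centered_mass_gt0 : \int[mu]_(s in D) Y s = 0 -> 0 < G 0.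
Proof.
move=> Y0; rewrite lt_def G0 andbT; apply/eqP => GE0.
have [h h0] := superlevel_mass_lt V0; rewrite GE0 add0r ltNge => /negP; apply.
(* Y is below the staircase with values - h, 0 and B, jumping at - h and 0. With mean zero and [G 0]
   = 0 this gives V <= G(- h), contrary to the choice of h. *)
have := @Rintegral_le_steps (- h) 2 (fun i => if i is 0%N then h else B)
  (fun i => if i is 0%N then - h else 0).
rewrite !big_ord_recr !big_ord0 /= GE0 Y0 mulr0 addr0 add0r.
move=> H; have {}H : 0 <= - h * V + h * G (- h).
  apply: H => s Ds; rewrite !big_ord_recr big_ord0 /= add0r.
  have := YB Ds; rewrite ler_norml => /andP[_ YsB].
  have [Y1|Y1] := leP 0 (Y s).
    rewrite (_ : - h <= Y s); first by rewrite !mulr1; lra.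
    by rewrite (le_trans _ Y1)// oppr_le0 ltW.
  have [Y2|Y2] := leP (- h) (Y s); rewrite ?mulr1 ?mulr0; lra.
by rewrite -(ler_pM2l h0); lra.
Qed.

(** Gruenbaum's inequality on a grid of step h, with y the relative increment of [G] from 0 to - h.
    The geometric sequence of ratio r = 1/(1 + y) through G(- h) and G 0 dominates [G] on the grid.
    Mean zero and the staircase bound give (m + 1) V <= sum of [G] over the grid, and summing the
    series yields (m + 1) V r^(m + 1) (1 - r) <= G 0. *)
Let centered_mass_step (h : R) (y := (G (- h) - G 0) / G 0) :
  \int[mu]_(s in D) Y s = 0 -> 0 < h -> V * expR (- 1) * (1 - y) <= G 0 * (1 + y).
Proof.
move=> Y0 h0; have p0 := centered_mass_gt0 Y0.
have e10 := expR_ge0 (- 1 : R).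
have y0 : 0 <= y by rewrite divr_ge0 ?subr_ge0 ?Gmono// oppr_le0 ltW.
have yE : G (- h) = G 0 * (1 + y).
  by rewrite mulrDr mulr1 /y mulrC divfK ?gt_eqF// addrC subrK.
(* For y > 1 the left-hand side is negative. *)
have [y1|y1] := ltP 1 y.
  apply: (@le_trans _ _ 0); last by rewrite mulr_ge0// addr_ge0.
  by rewrite mulr_ge0_le0 ?subr_le0 1?ltW// mulr_gt0// expR_gt0.
have geom m : let u i := G ((i%:R - m.+1%:R) * h) in
    forall i, u i * (1 + y)^-1 ^+ m.+1 <= G 0 * (1 + y)^-1 ^+ i.
  move=> u; have uE i : u i = G (- (m.+1%:R * h) + i%:R * h).
    by rewrite /u mulrBl addrC.
  have um1 : u m.+1 = G 0 by rewrite /u subrr mul0r.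
  have um : u m = G (- h) by rewrite /u -[m.+1%:R]natr1 opprD addrA subrr sub0r mulN1r.
  have [u0 u1 u2] := progression (- (m.+1%:R * h)) h0.
  have := @log_concave_seq_geometric R u m; rewrite um1 um yE invfM mulrA divff ?gt_eqF// mul1r.
  by apply => // i; rewrite ?uE//.
(* For y = 0 the dominating sequence is constant; reaching back below - B gives V <= G 0. *)
have [y00|yn0] := eqVneq y 0.
  rewrite y00 subr0 addr0 !mulr1.
  have [m mB] : exists m : nat, B <= m.+1%:R * h.
    exists (Num.truncn (B / h)); rewrite -ler_pdivrMr// ltW//.
    exact: truncnS_gt.
  have := geom m 0%N; rewrite y00 addr0 invr1 !expr1n !mulr1 sub0r.
  rewrite (Gfull (t := - m.+1%:R * h)); last by rewrite mulNr lerN2.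
  apply: le_trans; rewrite ger_pMr// -expR0 ler_expR; lra.
have yp : 0 < y by rewrite lt_def yn0.
(* [m.+1] is the integer part of 1/y, positive since y <= 1. Hence 1 - y <= (m + 1) y <= 1, and r >=
   exp(- y) yields r^(m + 1) >= 1/e. *)
pose m := (Num.truncn y^-1).-1.
have mtr : m.+1 = Num.truncn y^-1.
  by rewrite prednK// truncn_gt0 -invr1 lef_pV2 ?posrE.
have my : m.+1%:R * y <= 1.
  by rewrite mtr -ler_pdivlMr// mul1r truncn_le// invr_ge0.
have my2 : 1 - y <= m.+1%:R * y.
  have : y^-1 < m.+1%:R + 1 by rewrite natr1 mtr truncnS_gt.
  rewrite -(ltr_pM2r yp) mulVf//; lra.
pose r := (1 + y)^-1.
have r0 : 0 < r by rewrite invr_gt0 ltr_wpDr.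
have r1 : r < 1 by rewrite /r invf_lt1; lra.
have r1' : 0 <= 1 - r by rewrite subr_ge0 ltW.
have rE : 1 - r = y * r.
  by rewrite /r; field; rewrite gt_eqF// ltr_wpDr.
have rm : expR (- 1) <= r ^+ m.+1.
  apply: (@le_trans _ _ (expR (- y) ^+ m.+1)).
    rewrite -expRM_natl ler_expR; lra.
  apply: lerXn2r; rewrite ?nnegrE ?expR_ge0 ?(ltW r0)//.
  rewrite expRN lef_pV2 ?posrE ?expR_gt0 ?ltr_wpDr//; exact: expR_ge1Dx.
(* Enough steps for the top of the grid to exceed B, as [staircase_bound] demands. *)
pose n := (Num.truncn (B / h)).+1 + m.+1.
have YH s : D s -> Y s < (n%:R - m.+1%:R) * h.
  move=> Ds; have := YB Ds; rewrite ler_norml => /andP[_ YsB].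
  rewrite /n natrD addrK (le_lt_trans YsB)// -ltr_pdivrMr//.
  exact: truncnS_gt.
have := @Rintegral_le_steps (- (m.+1%:R * h)) n (fun=> h) (fun i => (i%:R - m.+1%:R) * h).
rewrite Y0 => /(_ (fun s Ds => staircase_bound h0 (YH s Ds))).
rewrite -mulr_sumr -mulNr => H.
have {}H : m.+1%:R * V <= \sum_(i < n) G ((i%:R - m.+1%:R) * h).
  rewrite -(ler_pM2l h0); lra.
have geo : (\sum_(i < n) G ((i%:R - m.+1%:R) * h)) * r ^+ m.+1 * (1 - r) <= G 0.
  apply: (@le_trans _ _ (G 0 * (\sum_(i < n) r ^+ i) * (1 - r))).
    by rewrite ler_wpM2r// mulr_suml mulr_sumr ler_sum// => i _; exact: geom.
  have := subrX1 r n => e; rewrite -mulrA ger_pMr//.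
  have := exprn_ge0 n (ltW r0); lra.
have H2 := ler_wpM2r (exprn_ge0 m.+1 (ltW r0)) H.
have yr1 : r * (1 + y) = 1 by rewrite /r mulVf// gt_eqF// ltr_wpDr.
have H3 := le_trans (ler_wpM2r r1' H2) geo.
have y10 : 0 <= 1 + y by rewrite addr_ge0.
have := ler_wpM2r y10 H3; apply: le_trans.
rewrite rE; have -> : m.+1%:R * V * r ^+ m.+1 * (y * r) * (1 + y) =
    V * r ^+ m.+1 * (m.+1%:R * y) * (r * (1 + y)) by ring.
rewrite yr1 mulr1 ler_pM//.
- by rewrite mulr_ge0// ltW.
- by rewrite subr_ge0.
- by rewrite ler_wpM2l// ltW.
Qed.

(** The limit h -> 0 in [centered_mass_step]: left continuity of [G] at 0 makes y as small as
    desired. *)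
Lemma gruenbaum : \int[mu]_(s in D) Y s = 0 -> V * expR (- 1) <= G 0.
Proof.
move=> Y0; have p0 := centered_mass_gt0 Y0; rewrite leNgt; apply/negP => lt.
have W0 : 0 < V * expR (- 1) by rewrite mulr_gt0// expR_gt0.
set W := V * expR (- 1) in lt W0.
have WG : 0 < W + G 0 by rewrite addr_gt0.
(* Chosen so that y < (W - G 0)/(W + G 0), the value at which W (1 - y) = G 0 (1 + y). *)
pose e := G 0 * ((W - G 0) / (W + G 0)).
have e0 : 0 < e by rewrite mulr_gt0// divr_gt0// subr_gt0.
have [h h0 Gh] := superlevel_mass_lt e0.
have := centered_mass_step Y0 h0; rewrite -/W; set y := (_ / _) => H.
have : y < (W - G 0) / (W + G 0).
  by rewrite /y ltr_pdivrMr// [ltRHS]mulrC ltrBlDl.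
rewrite ltr_pdivlMr//; lra.
Qed.

(** Chebyshev gives G(2 s) <= V/4 and G(- 2 s) >= 3V/4. The ratio is at most 1/3 over a step of 4 s,
    and by log-concavity every later step loses at least as much. *)
Lemma log_concave_tail (s : R) (k : nat) : 0 < s ->
  \int[mu]_(x in D) (Y x) ^+ 2 <= V * s ^+ 2 ->
  G (2 * s + k%:R * (4 * s)) <= V / 4 * 3^-1 ^+ k.
Proof.
move=> s0 var.
have s20 : 0 < (4 * s ^+ 2)^-1 by rewrite invr_gt0 mulr_gt0// exprn_gt0.
have intY2 : mu.-integrable D (EFin \o (fun x => (Y x) ^+ 2)).
  apply: (@bounded_integrable _ _ _ _ _ _ (B ^+ 2)) => //.
    exact: measurable_funX.
  by move=> x Dx; rewrite normrX lerXn2r ?nnegrE// YB.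
have chebyshev : \int[mu]_(x in D) ((4 * s ^+ 2)^-1 * (Y x) ^+ 2) <= V / 4.
  rewrite RintegralZl// mulrC ler_pdivrMr ?mulr_gt0 ?exprn_gt0//.
  by rewrite (le_trans var)//; lra.
have intC : mu.-integrable D (EFin \o (fun x => (4 * s ^+ 2)^-1 * (Y x) ^+ 2)).
  exact: (integrableZl mD _ intY2).
have c0 x : 0 <= (4 * s ^+ 2)^-1 * x ^+ 2.
  by rewrite mulr_ge0 ?sqr_ge0// ltW.
have c1 x : 2 * s <= `|x| -> 1 <= (4 * s ^+ 2)^-1 * x ^+ 2.
  move=> sx; rewrite mulrC ler_pdivlMr ?mulr_gt0 ?exprn_gt0// mul1r.
  rewrite -[leRHS]real_normK ?num_real// (_ : 4 * s ^+ 2 = (2 * s) ^+ 2); last by ring.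
  by rewrite lerXn2r ?nnegrE// mulr_ge0// ltW.
have upper : G (2 * s) <= V / 4.
  rewrite -Rintegral_step; apply: le_trans chebyshev; apply: le_Rintegral => // x Dx.
  have [Yx|_] := leP (2 * s) (Y x); last exact: c0.
  by apply: c1; rewrite (le_trans Yx)// ler_norm.
(* Chebyshev for the points with Y < - 2 s, whose indicator is written as 1 minus a step so that
   [Rintegral_steps] computes its integral. *)
have lower : V * (3 / 4) <= G (- (2 * s)).
  have [int e] := Rintegral_steps 1 1 (fun=> -1) (fun=> - (2 * s)).
  have : \int[mu]_(x in D) (1 + \sum_(i < 1) -1 * (- (2 * s) <= Y x)%R%:R) <= V / 4.
    apply: le_trans chebyshev; apply: le_Rintegral => // x Dx.
    rewrite big_ord1; have [Yx|Yx] := leP (- (2 * s)) (Y x).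
      by rewrite mulr1 subrr; exact: c0.
    rewrite mulr0 addr0; apply: c1.
    by rewrite -normrN (le_trans _ (ler_norm _))// ltW// ltrNr.
  rewrite e big_ord1; lra.
have s4 : 0 < 4 * s by rewrite mulr_gt0.
have [u0 u1 u2] := progression (- (2 * s)) s4.
pose u i := G (- (2 * s) + i%:R * (4 * s)).
have uS i : u i.+1 = G (2 * s + i%:R * (4 * s)).
  by rewrite /u -natr1; congr G; ring.
rewrite -uS.
have u1E : u 1%N = G (2 * s) by rewrite uS mul0r addr0.
have u0E : u 0%N = G (- (2 * s)) by rewrite /u mul0r addr0.
have V4 : 0 <= V / 4 by rewrite divr_ge0// ltW.
(* If G(2 s) = 0, no ratio is available, but monotonicity makes all later masses vanish. *)
have [z|nz] := eqVneq (u 1%N) 0.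
  apply: (@le_trans _ _ (u 1%N)); last by rewrite z mulr_ge0// exprn_ge0// invr_ge0.
  by elim: k => // k IH; exact: le_trans (u1 _) IH.
have up : 0 < u 1%N by rewrite lt_def nz u0.
have p0 : 0 < u 0%N by exact: lt_le_trans up (u1 0%N).
pose r := u 1%N / u 0%N; have r0 : 0 < r by rewrite divr_gt0.
have geo : u k.+1 * r ^+ 1 <= u 1%N * r ^+ k.+1.
  exact: (log_concave_seq_geometric u0 u1 u2 up).
move: geo; rewrite expr1 (exprSr r k) mulrA (ler_pM2r r0) => /le_trans; apply.
rewrite ler_pM ?u0 ?exprn_ge0 ?(ltW r0)//; first by rewrite u1E.
rewrite lerXn2r ?nnegrE ?invr_ge0 ?(ltW r0)//.
rewrite ler_pdivrMr//; move: upper lower; rewrite -u1E -u0E; lra.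
Qed.

End superlevel_masses.

(** * Row vectors and tuples *)

(** The map inside the definition of [vol]: by conversion, [vol K] is the mass of the preimage of
    [K]. *)
Definition row_of (R : realType) (d : nat) (s : d.-tuple (measurableTypeR R)) : 'rV[R]_d :=
  \row_i tnth s i.

Lemma row_of_mid (R : realType) (d : nat) (s t : d.-tuple (measurableTypeR R)) :
  row_of (tuple_mid s t) = 2^-1 *: (row_of s + row_of t).
Proof. by apply/rowP => i; rewrite !mxE tnth_mktuple mulrC. Qed.

(** An open set is the countable union of the cubes with rational centre and radius that it
    contains. *)
Lemma measurable_open_rows (R : realType) (d : nat) (U : set 'rV[R]_d) :
  open U -> measurable [set s | U (@row_of R d s)].
Proof.
move=> oU.
pose b (p : 'rV[rat]_d * rat) : set 'rV[R]_d := [set x | forall i,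
  ball (ratr (p.1 ord0 i) : R) (ratr p.2) (x ord0 i)].
pose F p : set (d.-tuple (measurableTypeR R)) :=
  if `[< b p `<=` U >] then [set s | forall i,
  ball (ratr (p.1 ord0 i) : R) (ratr p.2) (tnth s i : R)] else set0.
rewrite [X in measurable X](_ : _ = \bigcup_p F p).
  apply: countable_bigcupT_measurable => // p; rewrite /F; case: ifP => // _.
  apply: (@measurable_tuple_box R d
    (fun i => ball (ratr (p.1 ord0 i) : R) (ratr p.2))) => i.
  exact: measurable_ball.
apply/seteqP; split => [s /= Us|s [p _]]; last first.
  by rewrite /F; case: asboolP => // bU sp; apply: bU => i; rewrite mxE.
have /nbhs_ballP[e /= e0 eU] : nbhs (row_of s) U by apply: open_nbhs_nbhs.
(* With q < e/2 and the centre within q of the point, the cube of radius q lies in the e-ball around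
   the point. *)
have [q] := rat_in_itvoo (divr_gt0 e0 (ltr0n R 2)); rewrite in_itv/= => /andP[q0 qe].
have qi i : exists c : rat, `|tnth s i - ratr c : R| < ratr q.
  have /rat_in_itvoo[c] : (tnth s i : R) < (tnth s i : R) + ratr q by rewrite ltrDl.
  rewrite in_itv/= => /andP[c1 c2]; exists c.
  by rewrite ltr0_norm ?subr_lt0// opprB ltrBlDl.
have [c cP] := choice qi.
exists (\row_i c i, q) => //; rewrite /F; case: asboolP => [_ i|].
  by rewrite /ball/= mxE distrC; exact: cP.
case => x bx; apply: eU; split => // i j; rewrite ord1.
have := bx j; rewrite /ball/= !mxE => h1; have h2 := cP j.
rewrite (splitr e) -(subrKA (ratr (c j))) (le_lt_trans (ler_normD _ _))//.
by rewrite ltrD// ?(lt_trans h1)// (lt_trans h2).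
Qed.

Lemma measurable_closed_rows (R : realType) (d : nat) (K : set 'rV[R]_d) :
  closed K -> measurable [set s | K (@row_of R d s)].
Proof.
move=> cK; rewrite -[X in measurable X]setCK; apply: measurableC.
by apply: (@measurable_open_rows R d (~` K)); exact: closed_openC.
Qed.

Lemma compact_coord_bounded (R : realType) (d : nat) (K : set 'rV[R]_d) :
  compact K -> exists2 B, 0 <= B & forall x i, K x -> `|x ord0 i| <= B.
Proof.
move=> /compact_bounded [M [_ HM]]; exists (`|M| + 1); first by rewrite addr_ge0.
move=> x i Kx; have := HM (`|M| + 1); rewrite ltr_pwDr ?ler_norm// => /(_ isT x Kx).
apply: le_trans; rewrite [leRHS]mx_normrE.
by apply: (le_bigmax _ (fun ij => `|x ij.1 ij.2|) (ord0, i)).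
Qed.

Lemma convex_mid (R : realType) (d : nat) (K : set 'rV[R]_d) (x y : 'rV[R]_d) :
  @convex_set R 'rV[R]_d K -> K x -> K y -> K (2^-1 *: (x + y)).
Proof.
move=> cK Kx Ky.
have h0 : 0 <= 2^-1 :> R by rewrite invr_ge0.
have h1 : 2^-1 <= 1 :> R by rewrite invf_le1// ler1n.
have := cK x y (Itv01 h0 h1); rewrite !inE => /(_ Kx Ky).
rewrite /conv /= (_ : unstable.onem (2^-1) = 2^-1 :> R); last by rewrite /unstable.onem; lra.
by rewrite scalerDr.
Qed.

(** Prekopa-Leindler for the three indicators. *)
Lemma brunn_minkowski_mid (R : realType) (d : nat)
    (A B C : set (d.-tuple (measurableTypeR R))) (M : R) :
  0 <= M -> measurable A -> measurable B -> measurable C ->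
  (forall s i, A s -> `|tnth s i : R| <= M) ->
  (forall s i, B s -> `|tnth s i : R| <= M) ->
  (forall s t, A s -> B t -> C (tuple_mid s t)) ->
  (@lebesgue_tuple R d A * @lebesgue_tuple R d B <=
   @lebesgue_tuple R d C * @lebesgue_tuple R d C)%E.
Proof.
move=> M0 mA mB mC AM BM ABC.
have ind E : measurable E -> @lebesgue_tuple R d E =
    (\int[@lebesgue_tuple R d]_s (\1_E s)%:E)%E.
  by move=> mE; rewrite integral_indic// setIT.
rewrite (ind A)// (ind B)// (ind C)//.
have mind E : measurable E ->
    measurable_fun setT (fun s : d.-tuple (measurableTypeR R) => (\1_E s)%:E : \bar R).
  by move=> mE; apply/measurable_EFinP; exact: measurable_indic.
have ind01 (E : set (d.-tuple (measurableTypeR R))) s : (0 <= (\1_E s : R)%:E <= 1%:E)%E.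
  by rewrite !lee_fin indicE ler0n lern1 leq_b1.
apply: (@prekopa_leindler R d _ _ _ M 1) => //; try exact: mind.
- move=> s i; rewrite ltNge => /negP h; rewrite indicE memNset// => As.
  by apply: h; exact: AM.
- move=> s i; rewrite ltNge => /negP h; rewrite indicE memNset// => As.
  by apply: h; exact: BM.
move=> s t; rewrite !indicE; have [/set_mem As|_] := boolP (s \in A); last first.
  by rewrite mul0e -EFinM lee_fin mulr_ge0.
have [/set_mem Bt|_] := boolP (t \in B); last first.
  by rewrite mule0 -EFinM lee_fin mulr_ge0.
by rewrite (mem_set (ABC _ _ As Bt)).
Qed.

(** * The Euclidean inner product *)

Section inner_product.
Variables (R : realType) (d : nat).
Implicit Types u v w : 'rV[R]_d.

Lemma innerE u v : inner u v = (u *m v^T) ord0 ord0.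
Proof. by rewrite mxE; apply: eq_bigr => i _; rewrite mxE. Qed.

Lemma innerC u v : inner u v = inner v u.
Proof. by apply: eq_bigr => i _; rewrite mulrC. Qed.

Lemma innerDl u v w : inner (u + v) w = inner u w + inner v w.
Proof. by rewrite !innerE mulmxDl mxE. Qed.

Lemma innerZl a u w : inner (a *: u) w = a * inner u w.
Proof. by rewrite !innerE -scalemxAl mxE. Qed.

Lemma innerBl u v w : inner (u - v) w = inner u w - inner v w.
Proof. by rewrite !innerE mulmxBl !mxE. Qed.

Lemma innerZr a u w : inner u (a *: w) = a * inner u w.
Proof. by rewrite innerC innerZl innerC. Qed.

Lemma innerNr u w : inner u (- w) = - inner u w.
Proof. by rewrite -scaleN1r innerZr mulN1r. Qed.

Lemma inner_ge0 u : 0 <= inner u u.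
Proof. by apply: sumr_ge0 => i _; rewrite -expr2 sqr_ge0. Qed.

Lemma inner_gt0 u : u != 0 -> 0 < inner u u.
Proof.
move=> u0; rewrite lt_def inner_ge0 andbT; apply: contra u0 => /eqP uu.
apply/eqP/rowP => i; rewrite mxE; apply/eqP; rewrite -sqrf_eq0 expr2.
have /eqP := uu; rewrite psumr_eq0 => [/allP/(_ i)|j _]; last by rewrite -expr2 sqr_ge0.
by rewrite mem_index_enum => /(_ isT).
Qed.

Lemma inner_continuous w : continuous (fun u : 'rV[R]_d => inner u w).
Proof.
apply: (continuous_big (@add_continuous R)) => i _ u.
exact: (@continuousM R 'rV[R]_d (fun u => u ord0 i) (cst (w ord0 i)) u
  (@coord_continuous R 1 d ord0 i u) (@cst_continuous _ _ _ u)).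
Qed.

Lemma measurable_inner (g w : 'rV[R]_d) :
  measurable_fun setT
    (fun s : d.-tuple (measurableTypeR R) => inner (row_of s - g) w : R).
Proof. apply: measurable_sum => i.
apply: measurable_funM => //.
rewrite (_ : (fun s => _) = (fun s : d.-tuple (measurableTypeR R) => (tnth s i : R) - g ord0 i)).
  by apply: measurable_funB => //; exact: measurable_tnth.
by apply/funext => s; rewrite !mxE.
Qed.

End inner_product.

Lemma Rintegral_sum (R : realType) dd (T : measurableType dd)
    (mu : {measure set T -> \bar R}) (D : set T) (n : nat) (f : 'I_n -> T -> R) :
  measurable D -> (forall i, mu.-integrable D (EFin \o f i)) ->
  mu.-integrable D (EFin \o (fun s => \sum_i f i s)) /\
  \int[mu]_(s in D) (\sum_i f i s) = \sum_i \int[mu]_(s in D) f i s.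
Proof.
move=> mD intf.
have -> : EFin \o (fun s => \sum_i f i s) = (fun s => \sum_i (EFin \o f i) s)%E.
  by apply/funext => s; rewrite /= sumEFin.
split; first exact: integrable_sum.
rewrite /Rintegral.
under eq_integral do rewrite -sumEFin.
rewrite (integral_sum mD (f := fun i => EFin \o f i))//.
rewrite -sum_fine// => i _; exact: (integrable_fin_num mD (intf i)).
Qed.

(** * Moments of a convex body and its floating bodies *)

Lemma open_rows_gt0 (R : realType) (d : nat) (U : set 'rV[R]_d) :
  open U -> U !=set0 -> (0 < @lebesgue_tuple R d [set s | U (row_of s)])%E.
Proof.
move=> oU [x Ux].
have /nbhs_ballP[e /= e0 eU] : nbhs x U by apply: open_nbhs_nbhs.
apply: (@lt_le_trans _ _ ((2 * e) ^+ d)%:E).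
  by rewrite lte_fin exprn_gt0// mulr_gt0.
rewrite -(lebesgue_tuple_ball (fun i => x ord0 i) e0) le_measure ?inE//.
- apply: (@measurable_tuple_box R d (fun i => ball (x ord0 i) e)) => i.
  exact: measurable_ball.
- exact: measurable_open_rows.
by move=> s /= sx; apply: eU; split => // i j; rewrite ord1 mxE.
Qed.

Section convex_body_moments.
Variables (R : realType) (d : nat) (K : set 'rV[R]_d).
Hypothesis hK : convex_body K.

Let mu := @lebesgue_tuple R d.
Let D : set (d.-tuple (measurableTypeR R)) := [set s | K (row_of s)].
Let V := fine (mu D).

Let mD : measurable D.
Proof.
apply: measurable_closed_rows; have [cK _ _] := hK.
by apply: compact_closed => //; exact: norm_hausdorff.
Qed.

Let coord_bound : exists2 B : R, 0 <= B & forall s i, D s -> `|tnth s i : R| <= B.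
Proof.
have [/compact_coord_bounded[B B0 HB] _ _] := hK; exists B => // s i Ds.
by have := HB _ i Ds; rewrite mxE.
Qed.

Let D_fin : (mu D < +oo)%E.
Proof.
have [B B0 HB] := coord_bound.
have B1 : 0 < B + 1 by rewrite ltr_wpDl.
apply: (@le_lt_trans _ _ ((2 * (B + 1)) ^+ d)%:E); last by rewrite ltry.
rewrite -(lebesgue_tuple_ball (fun=> 0) B1) le_measure ?inE//.
  by apply: (@measurable_tuple_box R d (fun=> ball 0 (B + 1))) => i; exact: measurable_ball.
by move=> s Ds i; rewrite /ball/= sub0r normrN (le_lt_trans (HB _ i Ds))// ltrDl.
Qed.

Let D_gt0 : (0 < mu D)%E.
Proof.
have [_ _ K0] := hK.
apply: (lt_le_trans (open_rows_gt0 (@open_interior _ K) K0)).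
rewrite le_measure ?inE//.
- exact: measurable_open_rows (@open_interior _ K).
- by move=> s /= /interior_subset.
Qed.

Let VE : mu D = V%:E.
Proof. by rewrite fineK// ge0_fin_numE. Qed.

Let V_gt0 : 0 < V. Proof. by rewrite -lte_fin -VE. Qed.

Definition centered_form (g w : 'rV[R]_d) (s : d.-tuple (measurableTypeR R)) : R :=
  inner (row_of s - g) w.

Let measurable_centered_form g w : measurable_fun setT (centered_form g w).
Proof. exact: measurable_inner. Qed.

Let centered_form_bound g w : exists B : R, forall s, D s -> `|centered_form g w s| <= B.
Proof.
have [B B0 HB] := coord_bound.
exists (\sum_(i < d) (B + `|g ord0 i|) * `|w ord0 i|) => s Ds.
rewrite (le_trans (ler_norm_sum _ _ _))// ler_sum// => i _.
rewrite normrM ler_wpM2r// !mxE (le_trans (ler_normB _ _))// lerD2r.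
exact: HB.
Qed.

(** By convexity of [K] and linearity of the form, midpoints of the superlevel sets at a and b lie
    in the one at (a + b)/2. *)
Let superlevel_log_concave g w a b :
  (mu (D `&` [set s | (a <= centered_form g w s)%R]) *
   mu (D `&` [set s | (b <= centered_form g w s)%R]) <=
   mu (D `&` [set s | ((a + b) / 2 <= centered_form g w s)%R]) *
   mu (D `&` [set s | ((a + b) / 2 <= centered_form g w s)%R]))%E.
Proof.
have [B B0 HB] := coord_bound.
have mE t : measurable (D `&` [set s | t <= centered_form g w s]).
  apply: measurableI => //.
  rewrite (_ : [set s | _] = setT `&` centered_form g w @^-1` `[t, +oo[%classic).
    by apply: measurable_centered_form => //; exact: measurable_itv.
  by apply/seteqP; split => s /=; rewrite in_itv/= andbT; [|case].
apply: (brunn_minkowski_mid B0) => //.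
- by move=> s i [Ds _]; exact: HB.
- by move=> s i [Ds _]; exact: HB.
move=> s t [Ds /= sa] [Dt /= tb]; split.
  by rewrite /D /= row_of_mid; apply: convex_mid => //; have [] := hK.
rewrite /= /centered_form row_of_mid.
have -> : 2^-1 *: (row_of s + row_of t) - g =
    2^-1 *: ((row_of s - g) + (row_of t - g)).
  by apply/rowP => i; rewrite !mxE; lra.
rewrite innerZl innerDl; move: sa tb; rewrite /centered_form; lra.
Qed.

Let centered_form_integrable g w : mu.-integrable D (EFin \o centered_form g w).
Proof.
by have [B HB] := centered_form_bound g w; exact: (bounded_integrable mD D_fin _ HB).
Qed.

(** * Centroid and second moments *)

Definition centroid : 'rV[R]_d :=
  \row_i (V^-1 * \int[mu]_(s in D) (tnth s i : R)).

Lemma Rintegral_centered_form w : \int[mu]_(s in D) centered_form centroid w s = 0.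
Proof.
have [B B0 HB] := coord_bound.
have intt i : mu.-integrable D (EFin \o (fun s : d.-tuple (measurableTypeR R) => tnth s i : R)).
  apply: (bounded_integrable mD D_fin _ (fun s => HB s i)); exact: measurable_tnth.
have intc c : mu.-integrable D (EFin \o cst c).
  exact: (@bounded_integrable _ _ _ _ _ _ `|c|).
have intf i : mu.-integrable D (EFin \o (fun s : d.-tuple (measurableTypeR R) =>
    ((tnth s i : R) - centroid ord0 i) * w ord0 i)).
  apply: (integrableZr mD (w ord0 i)
    (f := EFin \o (fun s : d.-tuple (measurableTypeR R) => (tnth s i : R) - centroid ord0 i))).
  exact: (integrableB mD (intt i) (intc _)).
have [_] := Rintegral_sum mD intf.
rewrite (_ : (fun s => _) = centered_form centroid w); last first.
  by apply/funext => s; apply: eq_bigr => i _; rewrite !mxE.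
move=> ->; apply: big1 => i _.
rewrite RintegralZr//; last exact: (integrableB mD (intt i) (intc _)).
have cV : \int[mu]_(s in D) centroid ord0 i = \int[mu]_(s in D) (tnth s i : R).
  by rewrite (Rintegral_cst mu mD) mxE mulrAC mulVf ?mul1r ?gt_eqF.
by rewrite (RintegralB mD (intt i) (intc _)) cV subrr mul0r.
Qed.

(** The integrals are not divided by the volume: this is V times the covariance matrix, whence the
    factors V below. *)
Definition second_moments : 'M[R]_d := \matrix_(i, j)
  \int[mu]_(s in D) (((tnth s i : R) - centroid ord0 i) * ((tnth s j : R) - centroid ord0 j)).

(** Used with A = w^T w for the second moment of a linear form, and with A the inverse of
    [second_moments], where the trace is d. *)
Lemma Rintegral_quadratic (A : 'M[R]_d) :
  mu.-integrable D (EFin \o (fun s =>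
    ((row_of s - centroid) *m A *m (row_of s - centroid)^T) ord0 ord0)) /\
  \int[mu]_(s in D) (((row_of s - centroid) *m A *m (row_of s - centroid)^T) ord0 ord0) =
    \tr (A *m second_moments).
Proof.
have [B B0 HB] := coord_bound.
pose z i (s : d.-tuple (measurableTypeR R)) : R := (tnth s i : R) - centroid ord0 i.
have zB i s : D s -> `|z i s| <= B + `|centroid ord0 i|.
  by move=> Ds; rewrite (le_trans (ler_normB _ _))// lerD2r; exact: HB.
have mz i : measurable_fun setT (z i).
  by apply: measurable_funB => //; exact: measurable_tnth.
have int2 i j : mu.-integrable D (EFin \o (fun s => z i s * z j s)).
  apply: (@bounded_integrable _ _ _ _ _ _ ((B + `|centroid ord0 i|) * (B + `|centroid ord0 j|))) => //.
    exact: measurable_funM.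
  by move=> s Ds; rewrite normrM ler_pM// zB.
have int2A i j : mu.-integrable D (EFin \o (fun s => A i j * (z i s * z j s))).
  exact: (integrableZl mD _ (int2 i j)).
have intj i := Rintegral_sum mD (int2A i).
have [int eq] := Rintegral_sum mD (fun i => (intj i).1).
have quadE : (fun s => ((row_of s - centroid) *m A *m (row_of s - centroid)^T) ord0 ord0) =
    (fun s => \sum_i \sum_j A i j * (z i s * z j s)).
  apply/funext => s; rewrite mxE exchange_big; apply: eq_bigr => j _ /=.
  have uE i : (row_of s - centroid) ord0 i = z i s.
    by rewrite [LHS]mxE; congr (_ + _); rewrite mxE.
  rewrite !mxE mulr_suml; apply: eq_bigr => i _; rewrite -!uE !mxE; ring.
rewrite quadE; split => //.
rewrite eq; apply: eq_bigr => i _; rewrite (intj i).2 mxE.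
apply: eq_bigr => j _; rewrite (RintegralZl _ mD (int2 i j)) mxE; congr (_ * _).
by apply: eq_Rintegral => s _; rewrite mulrC.
Qed.

Let centered_form_sqr w s : centered_form centroid w s ^+ 2 =
  ((row_of s - centroid) *m (w^T *m w) *m (row_of s - centroid)^T) ord0 ord0.
Proof.
rewrite /centered_form expr2 {2}innerC !innerE.
rewrite mulmxA -[in RHS]mulmxA [in RHS]mxE big_ord1.
by rewrite -!innerE.
Qed.

Lemma Rintegral_centered_form_sqr w :
  \int[mu]_(s in D) (centered_form centroid w s) ^+ 2 = inner (w *m second_moments) w.
Proof.
under eq_Rintegral do rewrite centered_form_sqr.
have [_ ->] := Rintegral_quadratic (w^T *m w).
by rewrite -mulmxA mxtrace_mulC innerE /mxtrace big_ord1.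
Qed.

Let centered_form_sqr_integrable w :
  mu.-integrable D (EFin \o (fun s => (centered_form centroid w s) ^+ 2)).
Proof.
rewrite (_ : (fun s => _) = fun s => ((row_of s - centroid) *m (w^T *m w) *m
    (row_of s - centroid)^T) ord0 ord0); last by apply/funext => s; exact: centered_form_sqr.
by have [] := Rintegral_quadratic (w^T *m w).
Qed.

(** The form is non-zero somewhere in the interior of [K], hence bounded away from 0 on an open
    subset, which has positive volume. *)
Lemma second_moments_pos w : w != 0 -> 0 < inner (w *m second_moments) w.
Proof.
move=> w0; rewrite -Rintegral_centered_form_sqr.
have [_ _ [x0 Kx0]] := hK.
have ww := inner_gt0 w0.
have [x Kx fx] : exists2 x, K° x & inner (x - centroid) w != 0.
  (* If the form vanishes at x0, a small shift along w stays in the interior and changes its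
     value. *)
  have [z|nz] := eqVneq (inner (x0 - centroid) w) 0; last by exists x0.
  have : \forall t \near (0 : R), K° (x0 + t *: w).
    have : (fun t : R => x0 + t *: w) t @[t --> (0 : R)] --> x0 + (0 : R) *: w.
      apply: cvgD; first exact: cvg_cst.
      by apply: cvgZr_tmp; exact: cvg_id.
    rewrite scale0r addr0; apply.
    by apply: open_nbhs_nbhs; split => //; exact: open_interior.
  move=> /nbhs_ballP[e /= e0 He]; exists (x0 + (e / 2) *: w).
    apply: He; rewrite /ball/= sub0r normrN gtr0_norm ?divr_gt0//.
    by rewrite ltr_pdivrMr// ltr_pMr// ltr1n.
  rewrite addrAC innerDl innerZl z add0r mulf_neq0// ?gt_eqF//.
  by rewrite divr_gt0.
pose c := `|inner (x - centroid) w| / 2.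
have c0 : 0 < c by rewrite divr_gt0// normr_gt0.
pose U := K° `&` [set y | c < `|inner (y - centroid) w|].
have oU : open U.
  apply: openI; first exact: open_interior.
  have cont : continuous (fun y : 'rV[R]_d => `|inner (y - centroid) w|).
    have c1 : continuous (fun y : 'rV[R]_d => y - centroid).
      move=> y; apply: (@continuousB R 'rV[R]_d 'rV[R]_d id (fun=> centroid) y).
        by move=> A.
      exact: cst_continuous.
    move=> y.
    apply: (@continuous_comp _ _ _ (fun y : 'rV[R]_d => inner (y - centroid) w)
      (fun r : R => `|r|)); last exact: norm_continuous.
    exact: (@continuous_comp _ _ _ (fun y : 'rV[R]_d => y - centroid)
      (fun y => inner y w) y (c1 y) (@inner_continuous R d w _)).
  by apply: (@open_comp _ _ _ [set r | c < r]) => [y _|]; [exact: cont|exact: open_gt].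
have U0 : U !=set0.
  exists x; split => //=; rewrite /c ltr_pdivrMr// ltr_pMr ?ltr1n// normr_gt0//.
have mU := measurable_open_rows oU.
set W := [set s | U (row_of s)] in mU.
have WD : W `<=` D by move=> s [/interior_subset].
have Wfin : (mu W < +oo)%E by rewrite (le_lt_trans _ D_fin)// le_measure ?inE.
have intW1 : mu.-integrable D (EFin \o \1_W).
  apply: (@bounded_integrable _ _ _ _ _ _ 1) => //.
  by move=> s _; rewrite indicE ger0_norm ?ler0n// lern1 leq_b1.
have intW : mu.-integrable D (EFin \o (fun s => c ^+ 2 * \1_W s)).
  exact: (integrableZl mD (c ^+ 2) intW1).
have WE : \int[mu]_(s in D) (c ^+ 2 * \1_W s) = c ^+ 2 * fine (mu W).
  by rewrite (RintegralZl _ mD intW1) /Rintegral integral_indic// setIidl.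
apply: (@lt_le_trans _ _ (c ^+ 2 * fine (mu W))).
  rewrite mulr_gt0 ?exprn_gt0// fine_gt0// Wfin andbT.
  exact: open_rows_gt0.
rewrite -WE; apply: le_Rintegral => // s Ds; rewrite indicE.
have [/set_mem [_ /= cs]|_] := boolP (s \in W); last by rewrite mulr0 sqr_ge0.
by rewrite mulr1 -[leRHS]real_normK ?num_real// lerXn2r ?nnegrE ?(ltW c0)// ltW.
Qed.

Lemma second_moments_unit : second_moments \in unitmx.
Proof.
rewrite unitmxE unitfE; apply/negP => /det0P[v v0 vS].
have := second_moments_pos v0; rewrite vS innerE mul0mx mxE.
by rewrite ltxx.
Qed.

(* The average of [(x - c) S^-1 (x - c)^T] over [K] is [d / V]. *)
Lemma wide_direction : (0 < d)%N -> exists x w, exists q : R,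
  [/\ K x, 0 < q, d%:R / 2 <= q * V, inner (x - centroid) w = q &
      \int[mu]_(s in D) (centered_form centroid w s) ^+ 2 = q].
Proof.
move=> d0; pose Q (x : 'rV[R]_d) : R :=
  ((x - centroid) *m invmx second_moments *m (x - centroid)^T) ord0 ord0.
have [int e] := Rintegral_quadratic (invmx second_moments).
rewrite mulVmx ?second_moments_unit// mxtrace1 in e.
(* Otherwise Q < d/(2V) on [K], and its integral, which is d, would be at most d/2. *)
have [x Kx Qx] : exists2 x, K x & d%:R / 2 <= Q x * V.
  apply: contrapT => /forall2NP noQ.
  have : \int[mu]_(s in D) Q (row_of s) <= \int[mu]_(s in D) (d%:R / 2 / V).
    apply: le_Rintegral => //.
      exact: (@bounded_integrable _ _ _ _ _ _ `|d%:R / 2 / V|).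
    move=> s Ds; have [//|/negP] := noQ (row_of s).
    by rewrite -ltNge -ltr_pdivlMr// => /ltW.
  rewrite e (Rintegral_cst mu mD) divfK ?gt_eqF// ler_pdivlMr// ger_pMr ?ltr0n//.
  by rewrite lern1.
(* For this w, the value of the form at x and the integral of its square are both Q x. *)
have qE : inner (x - centroid) ((x - centroid) *m invmx second_moments) = Q x.
  by rewrite innerC innerE.
exists x, ((x - centroid) *m invmx second_moments), (Q x); split => //.
  rewrite -(pmulr_lgt0 _ V_gt0); apply: lt_le_trans Qx.
  by rewrite divr_gt0// ltr0n.
by rewrite Rintegral_centered_form_sqr -mulmxA mulVmx ?second_moments_unit// mulmx1.
Qed.

(** * Position of the floating body *)

Let mset (t : R) g w : measurable [set s | (t <= centered_form g w s)%R].
Proof.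
rewrite (_ : [set s | _] = setT `&` centered_form g w @^-1` `[t, +oo[%classic).
  by apply: measurable_centered_form => //; exact: measurable_itv.
by apply/seteqP; split => s /=; rewrite in_itv/= andbT; [|case].
Qed.

(** Cutting off a cap of volume at most delta V leaves a half-space that takes part in the
    intersection defining the floating body. *)
Lemma floating_body_le w T delta y : w != 0 ->
  fine (mu (D `&` [set s | (T <= centered_form centroid w s)%R])) <= delta * V ->
  floating_body K delta y -> inner (y - centroid) w <= T.
Proof.
move=> w0 Ew Fy; pose n := enorm w.
have n0 : 0 < n by rewrite sqrtr_gt0 inner_gt0.
have n2 : n ^+ 2 = inner w w by rewrite sqr_sqrtr// inner_ge0.
(* Half-spaces are given by lower bounds, so the upper bound T is encoded by the unit normal -
   w/|w|. *)
pose th := - (n^-1 *: w); pose t := - (n^-1 * (T + inner centroid w)).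
have hE z : halfspace th t z <-> inner (z - centroid) w <= T.
  rewrite /halfspace /= innerNr innerZr lerN2 ler_pM2l ?invr_gt0// innerBl.
  by rewrite lerBlDr.
apply/hE; apply: (Fy (th, t)); split => /=.
  rewrite /unit_sphere /= /enorm innerNr innerC innerNr opprK innerZr innerC innerZr -n2.
  by rewrite expr2 mulKf ?gt_eqF// mulVf ?gt_eqF// sqrtr1.
have mH : measurable [set s | (halfspace th t `&` K) (row_of s)].
  rewrite (_ : [set s | _] = D `&` [set s | (- T <= centered_form centroid (- w) s)%R]).
    exact: measurableI.
  apply/seteqP; split => s /= [].
    by move/hE => h Ks; split => //; rewrite /centered_form innerNr lerN2.
  by move=> Ks; rewrite /centered_form innerNr lerN2 => h; split => //; exact/hE.
have mE := measurableI _ _ mD (mset T centroid w).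
have : (mu D <= mu [set s | (halfspace th t `&` K) (row_of s)] +
    mu (D `&` [set s | (T <= centered_form centroid w s)%R]))%E.
  apply: le_trans (measureU2 _ _ _) => //.
  rewrite le_measure ?inE//; first exact: measurableU.
  move=> s Ds; have [h|h] := leP (inner (row_of s - centroid) w) T.
    by left; split => //; exact/hE.
  by right; split => //=; exact: ltW.
rewrite -[X in (_ <= _ + X)%E]fineK; last first.
  by rewrite ge0_fin_numE// (le_lt_trans _ D_fin)// le_measure ?inE.
move=> h; have {}h : (V%:E <= mu [set s | (halfspace th t `&` K) (row_of s)] + (delta * V)%:E)%E.
  by rewrite -VE; apply: (le_trans h); rewrite leeD2l// lee_fin.
rewrite -[vol K]/(mu D) VE -EFinM -[vol _]/(mu _).
by rewrite mulrBl mul1r EFinB leeBlDr.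
Qed.

(** A half-space missing the centroid is disjoint from the opposite half-space bounded at the
    centroid. The latter has mass at least V/e by Gruenbaum, leaving less than (1 - delta) V. *)
Lemma floating_body_centroid delta : delta < expR (- 1) -> floating_body K delta centroid.
Proof.
move=> de [th t] [_ /= volH]; rewrite /halfspace /= leNgt; apply/negP => ct.
pose E := D `&` [set s | (0 <= centered_form centroid (- th) s)%R].
have [B HB] := centered_form_bound centroid (- th).
have := gruenbaum mD D_gt0 D_fin (@measurable_centered_form _ _) HB
  (@superlevel_log_concave _ _) (Rintegral_centered_form _).
rewrite -/V -/E => grun.
have mE : measurable E by exact: measurableI.
have EE : mu E = (fine (mu E))%:E.
  rewrite fineK// ge0_fin_numE// (le_lt_trans _ D_fin)// le_measure ?inE//.
  exact: subIsetl.
have mH : measurable [set s | (halfspace th t `&` K) (row_of s)].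
  rewrite (_ : [set s | _] = D `&` [set s | (t <= centered_form 0 th s)%R]).
    exact: measurableI.
  have fE s : centered_form 0 th s = inner (row_of s) th by rewrite /centered_form subr0.
  apply/seteqP; split => s /= [h1 h2].
    by split => //=; rewrite fE.
  by split => //; rewrite fE in h2.
have EH0 : [set s | (halfspace th t `&` K) (row_of s)] `&` E = set0.
  rewrite -subset0 => s [[/= h _] [_]]; rewrite /= /centered_form innerNr innerBl.
  move: h; rewrite /halfspace /=; lra.
have : (mu [set s | (halfspace th t `&` K) (row_of s)] + mu E <= mu D)%E.
  rewrite -measureU// le_measure ?inE//; first exact: measurableU.
  by move=> s [[]|[]].
have := volH; rewrite -[vol K]/(mu D) -[vol _]/(mu _) VE EE -EFinM => h1 h2.
have : ((1 - delta) * V + fine (mu E) <= V)%R.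
  by rewrite -lee_fin EFinD; apply: le_trans h2; rewrite leeD2r.
have := ltr_pM2l V_gt0 delta (expR (-1)); rewrite de; lra.
Qed.

(** The tail bound for w and for - w: both caps have volume at most 3^(- k) V/4 <= delta V. *)
Lemma floating_body_slab w (sigma delta : R) (k : nat) y : w != 0 -> 0 < sigma ->
  \int[mu]_(s in D) (centered_form centroid w s) ^+ 2 <= V * sigma ^+ 2 ->
  3^-1 ^+ k <= delta -> floating_body K delta y ->
  `|inner (y - centroid) w| <= 2 * sigma + k%:R * (4 * sigma).
Proof.
move=> w0 s0 var kd Fy.
have side v : v != 0 -> \int[mu]_(s in D) (centered_form centroid v s) ^+ 2 <= V * sigma ^+ 2 ->
    inner (y - centroid) v <= 2 * sigma + k%:R * (4 * sigma).
  move=> v0 vv; apply: floating_body_le Fy => //.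
  have [B HB] := centered_form_bound centroid v.
  have := log_concave_tail mD D_gt0 D_fin (@measurable_centered_form _ _) HB
    (@superlevel_log_concave _ _) k s0 vv.
  move=> /le_trans; apply; rewrite -/V mulrAC.
  have := ler_wpM2l (ltW V_gt0) kd; have := mulr_ge0 (ltW V_gt0) (exprn_ge0 k (_ : 0 <= 3^-1 :> R)).
  by rewrite invr_ge0 => /(_ (ler0n _ _)); lra.
rewrite ler_norml; apply/andP; split; last exact: side.
rewrite lerNl -innerNr; apply: side; first by rewrite oppr_eq0.
by under eq_Rintegral do rewrite /centered_form innerNr sqrrN.
Qed.

(** Take x, w, q from [wide_direction] and sigma^2 = q/V, the variance along w. Both z and the
    contraction of x towards z lie in the slab of half-width T, so with a = <z - c, w> one has a +
    (q - a)/lambda <= T and |a| <= T. Hence q <= 3 lambda T, and squaring gives the claim because q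
    V >= d/2. *)
Lemma dilation_factor_ge (delta lambda : R) (k : nat) (z : 'rV[R]_d) :
  (0 < d)%N -> 3^-1 ^+ k <= delta -> 1 <= lambda -> floating_body K delta z ->
  dilate z lambda^-1 K `<=` floating_body K delta ->
  d%:R / 2 <= (3 * lambda * (2 + 4 * k%:R)) ^+ 2.
Proof.
move=> d0 kd l1 Fz zK.
have [x [w [q [Kx q0 qV xq varq]]]] := wide_direction d0.
have w0 : w != 0.
  apply/eqP => w0; move: q0; rewrite -xq w0 innerC innerE mul0mx mxE.
  by rewrite ltxx.
have l0 : 0 < lambda by exact: lt_le_trans l1.
pose sigma := Num.sqrt (q / V).
have s2 : sigma ^+ 2 = q / V by rewrite sqr_sqrtr// divr_ge0 ?ltW.
have s0 : 0 < sigma by rewrite sqrtr_gt0 divr_gt0.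
have var : \int[mu]_(s in D) (centered_form centroid w s) ^+ 2 <= V * sigma ^+ 2.
  by rewrite varq s2 mulrC divfK ?gt_eqF.
have slab y := @floating_body_slab w sigma delta k y w0 s0 var kd.
set T := _ + _ in slab.
have TE : T = sigma * (2 + 4 * k%:R) by rewrite /T; ring.
have T0 : 0 <= T by rewrite TE mulr_ge0 ?(ltW s0)// addr_ge0// mulr_ge0.
have := slab _ Fz; set a := inner (z - centroid) w; rewrite ler_norml => /andP[a1 a2].
have /slab : floating_body K delta (lambda^-1 *: (x - z) + z).
  by apply: zK; exists x.
rewrite -addrA innerDl innerZl -/a ler_norml => /andP[_ h].
have xz : inner (x - z) w = q - a by rewrite -xq /a !innerBl; ring.
rewrite xz in h.
have h2 : q - a <= lambda * (2 * T).
  by rewrite mulrC -ler_pdivrMr//; move: h; rewrite [_ / lambda]mulrC; lra.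
have qT : q <= sigma * (3 * lambda * (2 + 4 * k%:R)).
  have -> : sigma * (3 * lambda * (2 + 4 * k%:R)) = lambda * (3 * T) by rewrite TE; ring.
  have := ler_wpM2r T0 l1; lra.
apply: (le_trans qV).
have : q ^+ 2 <= q / V * (3 * lambda * (2 + 4 * k%:R)) ^+ 2.
  by rewrite -s2 -exprMn lerXn2r ?nnegrE// ltW// (lt_le_trans q0).
by rewrite expr2 -mulrA ler_pM2l// ler_pdivlMl// mulrC.
Qed.

End convex_body_moments.

(** * Numerical constants and conclusion *)

(** From exp(-1/8) >= 7/8 one gets e <= (8/7)^8 < 3. *)
Lemma expR1_le3 (R : realType) : expR 1 <= 3 :> R.
Proof.
have e8 : expR (8^-1) <= 8 / 7 :> R.
  rewrite -[leLHS]invrK -expRN -[leRHS]invrK lef_pV2 ?posrE ?invr_gt0 ?expR_gt0 ?divr_gt0//.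
  by rewrite invf_div; apply: le_trans (expR_ge1Dx _); lra.
have -> : expR 1 = expR (8^-1) ^+ 8 :> R.
  by rewrite -expRM_natl mulfV.
apply: (@le_trans _ _ ((8 / 7) ^+ 8)); last by lra.
by rewrite lerXn2r ?nnegrE ?expR_ge0// divr_ge0.
Qed.

(** With l = log(1/delta) > 1 and k the integer part of l plus 1, 3^(- k) <= exp(- l) = delta, while
    3 (2 + 4 k) <= 18 + 12 l <= 30 l. *)
Lemma exponent_choice (R : realType) (delta : R) : 0 < delta -> delta < expR (- 1) ->
  exists k : nat, 3^-1 ^+ k <= delta /\ 3 * (2 + 4 * k%:R) <= 30 * ln (2 * delta^-1).
Proof.
move=> d0 d1; pose l := ln delta^-1.
have di0 : 0 < delta^-1 by rewrite invr_gt0.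
have l1 : 1 < l.
  by rewrite -[1]expRK ltr_ln ?posrE ?expR_gt0// -[expR 1]invrK -expRN ltf_pV2 ?posrE ?expR_gt0.
have l2 : l <= ln (2 * delta^-1).
  by rewrite ler_ln ?posrE ?mulr_gt0// ler_peMl ?ler1n// ltW.
pose k := (Num.truncn l).+1; exists k; split.
  have lk : l <= k%:R by rewrite ltW// truncnS_gt.
  have -> : delta = expR (- l) by rewrite /l lnV ?posrE// opprK lnK.
  apply: (@le_trans _ _ (expR (-1) ^+ k)).
    rewrite lerXn2r ?nnegrE ?expR_ge0 ?invr_ge0//.
    by rewrite expRN lef_pV2 ?posrE ?expR_gt0 ?expR1_le3.
  by rewrite -expRM_natl ler_expR mulrN1 lerN2.
have : (Num.truncn l)%:R <= l by rewrite truncn_le// (le_trans _ (ltW l1)).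
rewrite /k -natr1; lra.
Qed.

Theorem theorem3 (R : realType) :
  exists c : R, 0 < c /\
    forall (d : nat) (K : set 'rV[R]_d) (delta : R),
      (0 < d)%N -> convex_body K -> 0 < delta -> delta < expR (- 1) ->
      floating_body K delta !=set0 /\
      ((c * d%:R `^ (1 / 4) / ln (2 * delta^-1))%:E
         <= log_hausdorff K (floating_body K delta))%E.
Proof.
(* For X = lambda log(2/delta), the bound d/2 <= (30 X)^2 gives sqrt d <= 30 sqrt 2 X, and 60
   exceeds 30 sqrt 2. *)
exists 60^-1; split=> [|d K delta d0 hK de0 de1]; first by rewrite invr_gt0.
split; first by exists (centroid K); exact: floating_body_centroid.
apply: le_ereal_inf_tmp => _ [lambda [l1 [z [zint zK _]]] <-]; rewrite lee_fin.
have [k [kd kl]] := exponent_choice de0 de1.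
have [_ Fz] := interior_subset zint.
have := dilation_factor_ge hK d0 kd l1 Fz zK => bound.
have d1 : 1 <= d%:R :> R by rewrite ler1n.
have L0 : 0 < ln (2 * delta^-1).
  have : 0 <= k%:R :> R by [].
  move: kl; lra.
have lam0 : 0 <= lambda by rewrite (le_trans _ l1).
rewrite ler_pdivrMr// mulrC ler_pdivrMr//.
(* As d >= 1, d^(1/4) is at most sqrt d. *)
apply: (@le_trans _ _ (Num.sqrt d%:R)).
  by rewrite -powR12_sqrt// ler_powR//; lra.
set X := lambda * ln (2 * delta^-1).
have X0 : 0 <= X by rewrite mulr_ge0// ltW.
have M0 : 0 <= 3 * lambda * (2 + 4 * k%:R).
  by rewrite !mulr_ge0// addr_ge0// mulr_ge0.
have MX : 3 * lambda * (2 + 4 * k%:R) <= 30 * X.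
  by rewrite /X [3 * lambda]mulrC -mulrA [leRHS]mulrCA ler_wpM2l.
have MX2 : (3 * lambda * (2 + 4 * k%:R)) ^+ 2 <= (30 * X) ^+ 2.
  by rewrite lerXn2r ?nnegrE// mulr_ge0.
have : Num.sqrt d%:R ^+ 2 <= (X * 60) ^+ 2.
  rewrite sqr_sqrtr//; have := le_trans bound MX2.
  have := sqr_ge0 X; rewrite !exprMn; lra.
by rewrite ler_pXn2r ?nnegrE ?sqrtr_ge0 ?(mulr_ge0 X0).
Qed.
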